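(* There is an absolute constant $C>0$ such that the following holds. Let $G=(V,E)$ be an $(n,d,\lambda)$-expander with $n\ge2$, $d$ even, and $\mathrm{girth}(G)=g$. Then for every rule $\mathcal{R}$ and every starting vertex, the greedy random walk on $G$ satisfies \[ \mathbb{E}[C_E(G)] \le |E| + C\,|E|\cdot\frac{\log n}{(1-\lambda)\,g}. \] In particular, for a family of such graphs with constant even degree $d$, $\lambda$ bounded away from $1$, and $\mathrm{girth}(G)=\Omega(\log n)$, the expected edge cover time is $O(n)$.
   Context: A greedy random walk (GRW) on a connected locally finite graph $G=(V,E)$ with rule $\mathcal{R}$ started at $v_0$: $X_0=v_0$; with $H_t=\{\{X_{s-1},X_s\}:0<s\le t\}$ and $J_t(v)=\{e\in E: v\in e, e\notin H_t\}$, if $J_t(X_t)\ne\emptyset$ then $X_{t+1}=w$ for some $w$ with $\{X_t,w\}\in J_t(X_t)$, chosen according to an arbitrary (possibly randomized, history-dependent) rule $\mathcal{R}$; if $J_t(X_t)=\emptyset$ then $X_{t+1}$ is a uniformly random neighbor of $X_t$. $C_E(G)=\min\{t:H_t=E\}$ is the edge cover time. For a $d$-regular graph on $n$ vertices with normalized adjacency matrix $A$ ($A(u,v)=1/d$ if $\{u,v\}\in E$, else $0$) and eigenvalues $1=\lambda_1\ge\dots\ge\lambda_n\ge-1$, set $\lambda(G)=\max_{2\le i\le n}|\lambda_i|$; $G$ is an $(n,d,\lambda)$-expander if $\lambda(G)<\lambda<1$. $\mathrm{girth}(G)$ is the minimal length of a cycle in $G$. *)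

(* Defs.v *)
From Stdlib Require Import Reals Lra Lia List Arith Bool.
Import ListNotations.
Open Scope R_scope.
Open Scope bool_scope.

Definition sumR (n : nat) (f : nat -> R) : R :=
  fold_right Rplus 0 (map f (seq 0 n)).

Definition sumN (n : nat) (f : nat -> nat) : nat :=
  fold_right Nat.add 0%nat (map f (seq 0 n)).

Definition simple_graph (n : nat) (adj : nat -> nat -> bool) : Prop :=
  (forall u v, adj u v = adj v u) /\
  (forall u, adj u u = false) /\
  (forall u v, adj u v = true -> (u < n)%nat /\ (v < n)%nat).

Definition degree (n : nat) (adj : nat -> nat -> bool) (u : nat) : nat :=
  sumN n (fun v => if adj u v then 1%nat else 0%nat).

Definition regular (n d : nat) (adj : nat -> nat -> bool) : Prop :=
  forall u, (u < n)%nat -> degree n adj u = d.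

Definition num_edges (n : nat) (adj : nat -> nat -> bool) : nat :=
  sumN n (fun u => sumN n (fun v => if (u <? v)%nat && adj u v then 1%nat else 0%nat)).

Definition normA (d : nat) (adj : nat -> nat -> bool) (u v : nat) : R :=
  if adj u v then / INR d else 0.

(* [lambda(G) < lam]: every eigenvalue lambda_2,...,lambda_n has absolute
   value < lam.  Since A is symmetric with A 1 = 1 and lambda_1 = 1,
   lambda_2..lambda_n (with multiplicity) are exactly the eigenvalues of A
   restricted to the invariant subspace orthogonal to the all-ones vector. *)
Definition spectral_gap_below (n d : nat) (adj : nat -> nat -> bool) (lam : R) : Prop :=
  forall (x : nat -> R) (mu : R),
    sumR n x = 0 ->
    (exists v, (v < n)%nat /\ x v <> 0) ->
    (forall u, (u < n)%nat -> sumR n (fun v => normA d adj u v * x v) = mu * x u) ->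
    Rabs mu < lam.

Definition expander (n d : nat) (adj : nat -> nat -> bool) (lam : R) : Prop :=
  simple_graph n adj /\ regular n d adj /\ spectral_gap_below n d adj lam /\ lam < 1.

Definition is_cycle (adj : nat -> nat -> bool) (c : list nat) : Prop :=
  (3 <= length c)%nat /\ NoDup c /\
  (forall i, (S i < length c)%nat -> adj (nth i c 0%nat) (nth (S i) c 0%nat) = true) /\
  adj (last c 0%nat) (nth 0 c 0%nat) = true.

Definition girth_eq (adj : nat -> nat -> bool) (g : nat) : Prop :=
  (exists c, is_cycle adj c /\ length c = g) /\
  (forall c, is_cycle adj c -> (g <= length c)%nat).

(* [used h u v]: the edge {u,v} is traversed in the walk prefix h = [X_0;..;X_t] *)
Fixpoint used (h : list nat) (u v : nat) : bool :=
  match h with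
  | a :: ((b :: _) as t) =>
      ((Nat.eqb a u && Nat.eqb b v) || (Nat.eqb a v && Nat.eqb b u)) || used t u v
  | _ => false
  end.

Definition unused_edge (adj : nat -> nat -> bool) (h : list nat) (w : nat) : bool :=
  adj (last h 0%nat) w && negb (used h (last h 0%nat) w).

Definition has_unused (n : nat) (adj : nat -> nat -> bool) (h : list nat) : bool :=
  existsb (unused_edge adj h) (seq 0 n).

(* A rule: given the history [X_0;..;X_t], a probability distribution on
   the w with {X_t,w} in J_t(X_t) (arbitrary, randomized, history-dependent). *)
Definition valid_rule (n : nat) (adj : nat -> nat -> bool) (Rl : list nat -> nat -> R) : Prop :=
  forall h, has_unused n adj h = true ->
    (forall w, 0 <= Rl h w) /\
    sumR n (fun w => if unused_edge adj h w then Rl h w else 0) = 1.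

Definition trans (n d : nat) (adj : nat -> nat -> bool) (Rl : list nat -> nat -> R)
  (h : list nat) (w : nat) : R :=
  if has_unused n adj h then (if unused_edge adj h w then Rl h w else 0)
  else (if adj (last h 0%nat) w then / INR d else 0).

Fixpoint expect (n d : nat) (adj : nat -> nat -> bool) (Rl : list nat -> nat -> R)
  (k : nat) (h : list nat) (f : list nat -> R) : R :=
  match k with
  | O => f h
  | S k' => sumR n (fun w => trans n d adj Rl h w * expect n d adj Rl k' (h ++ [w]) f)
  end.

Definition covered (n : nat) (adj : nat -> nat -> bool) (p : list nat) (t : nat) : bool :=
  forallb (fun u => forallb (fun v => negb (adj u v) || used (firstn (S t) p) u v)
                            (seq 0 n)) (seq 0 n).

Fixpoint cover_from (n : nat) (adj : nat -> nat -> bool) (p : list nat) (t k : nat) : nat :=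
  match k with
  | O => t
  | S k' => if covered n adj p t then t else cover_from n adj p (S t) k'
  end.

(* min(C_E, T) evaluated on a path p = [X_0;..;X_T] *)
Definition cover_trunc (n : nat) (adj : nat -> nat -> bool) (p : list nat) (T : nat) : nat :=
  cover_from n adj p 0 T.

Definition exp_cover_trunc (n d : nat) (adj : nat -> nat -> bool) (Rl : list nat -> nat -> R)
  (v0 T : nat) : R :=
  expect n d adj Rl T [v0] (fun p => INR (cover_trunc n adj p T)).

(* Main.v *)
Require Import Defs.
From Stdlib Require Import Reals List Arith ZArith Lra Lia Bool.
From Stdlib Require Import FunctionalExtensionality IndefiniteDescription Classical.
Import ListNotations.
Open Scope R_scope.

(** Since d is even, the unused degrees are even whenever the walk has no greedy
    excursion under way; so an excursion can only get stuck where it started, and it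
    is then a closed trail, which uses up at least g edges.  Between excursions the
    walk is a simple random walk until it hits the set S of vertices with unused
    edges.  With m unused edges left, |S| >= 2m/d, and by L^2 contraction (first mix
    for O(log n / (1 - lambda)) steps, then decay at rate 1 - (1 - lambda)|S|/(2n))
    the expected hitting time is at most H = O((nd/m + log n) / (1 - lambda)).
    As m drops by at least g per excursion, the random phases cost in total at most
    (1/g) times the sum of H over m = 1, ..., |E|.  This is implemented by a potential
    function of the history, with 2m replaced by the volume of the unused graph. *)

(** * Finite sums *)

(** The rule may depend on the whole history, so nothing renews between excursions; hence an
    induction on the remaining horizon, with estimates valid for each single history. All bounds
    concern the cover time cut off at T and are uniform in T. The spectral gap speaks of
    eigenvectors, whereas the walk needs contraction of the L^2 norm. The passage is variational: by
    compactness the norm of the averaging operator on mean-zero functions is attained, and a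
    maximizer yields an eigenvector. Each greedy step spends one edge, which gives the leading |E|.
    The logarithm has two sources: the harmonic sum of nd/m, and the mixing time summed over all
    edges. *)

Lemma sumR_S n f : sumR (S n) f = sumR n f + f n.
Proof.
  unfold sumR. rewrite seq_S, map_app, fold_right_app. simpl.
  generalize (map f (seq 0 n)); intros l; induction l as [|a l IH]; simpl; lra.
Qed.

Lemma sumN_S n f : sumN (S n) f = (sumN n f + f n)%nat.
Proof.
  unfold sumN. rewrite seq_S, map_app, fold_right_app. simpl.
  generalize (map f (seq 0 n)); intros l; induction l as [|a l IH]; simpl; lia.
Qed.

Lemma sumR_shift n f : sumR (S n) f = f 0%nat + sumR n (fun i => f (S i)).
Proof.
  induction n as [|n IH]; [unfold sumR; simpl; lra|].
  rewrite sumR_S, IH, sumR_S; lra.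
Qed.

Lemma sumR_ext n f f' : (forall i, (i < n)%nat -> f i = f' i) -> sumR n f = sumR n f'.
Proof.
  induction n as [|n IH]; intros H; [reflexivity|].
  rewrite !sumR_S, IH, H; auto with arith.
Qed.

Lemma sumN_ext n f f' : (forall i, (i < n)%nat -> f i = f' i) -> sumN n f = sumN n f'.
Proof.
  induction n as [|n IH]; intros H; [reflexivity|].
  rewrite !sumN_S, IH, H; auto with arith.
Qed.

Lemma sumR_plus n f f' : sumR n (fun i => f i + f' i) = sumR n f + sumR n f'.
Proof.
  induction n as [|n IH]; [unfold sumR; simpl; lra|]. rewrite !sumR_S, IH; lra.
Qed.

Lemma sumN_plus n f f' :
  sumN n (fun i => (f i + f' i)%nat) = (sumN n f + sumN n f')%nat.
Proof. induction n as [|n IH]; [reflexivity|]. rewrite !sumN_S, IH; lia. Qed.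

Lemma sumR_scal n c f : sumR n (fun i => c * f i) = c * sumR n f.
Proof.
  induction n as [|n IH]; [unfold sumR; simpl; lra|]. rewrite !sumR_S, IH; lra.
Qed.

Lemma sumR_const n c : sumR n (fun _ => c) = INR n * c.
Proof.
  induction n as [|n IH]; [unfold sumR; simpl; lra|]. rewrite sumR_S, IH, S_INR; lra.
Qed.

Lemma sumR_le n f f' :
  (forall i, (i < n)%nat -> f i <= f' i) -> sumR n f <= sumR n f'.
Proof.
  induction n as [|n IH]; intros H; [apply Rle_refl|]. rewrite !sumR_S.
  assert (sumR n f <= sumR n f') by auto with arith.
  assert (f n <= f' n) by auto with arith. lra.
Qed.

Lemma sumN_le n f f' :
  (forall i, (i < n)%nat -> (f i <= f' i)%nat) -> (sumN n f <= sumN n f')%nat.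
Proof.
  induction n as [|n IH]; intros H; [apply le_n|]. rewrite !sumN_S.
  assert (sumN n f <= sumN n f')%nat by auto with arith.
  assert (f n <= f' n)%nat by auto with arith. lia.
Qed.

Lemma sumR_nonneg n f : (forall i, (i < n)%nat -> 0 <= f i) -> 0 <= sumR n f.
Proof.
  intros H. rewrite <- (Rmult_0_r (INR n)), <- sumR_const. now apply sumR_le.
Qed.

Lemma sumR_ge_term n f i :
  (forall j, (j < n)%nat -> 0 <= f j) -> (i < n)%nat -> f i <= sumR n f.
Proof.
  induction n as [|n IH]; intros H Hi; [lia|]. rewrite sumR_S.
  destruct (Nat.eq_dec i n) as [->|Hn].
  - assert (0 <= sumR n f) by (apply sumR_nonneg; auto with arith). lra.
  - assert (f i <= sumR n f) by (apply IH; auto with arith; lia).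
    assert (0 <= f n) by auto with arith. lra.
Qed.

Lemma sumN_ge_term n f i : (i < n)%nat -> (f i <= sumN n f)%nat.
Proof.
  induction n as [|n IH]; intros Hi; [lia|]. rewrite sumN_S.
  destruct (Nat.eq_dec i n) as [->|Hn]; [lia|]. specialize (IH ltac:(lia)). lia.
Qed.

Lemma sumR_swap m n (f : nat -> nat -> R) :
  sumR m (fun i => sumR n (fun j => f i j)) = sumR n (fun j => sumR m (fun i => f i j)).
Proof.
  induction m as [|m IH].
  - rewrite (sumR_ext n _ (fun _ => 0)) by reflexivity. rewrite sumR_const. unfold sumR; simpl; lra.
  - rewrite sumR_S, IH, <- sumR_plus. apply sumR_ext; intros; now rewrite sumR_S.
Qed.

Lemma sumN_swap m n (f : nat -> nat -> nat) :
  sumN m (fun i => sumN n (fun j => f i j)) = sumN n (fun j => sumN m (fun i => f i j)).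
Proof.
  induction m as [|m IH].
  - unfold sumN at 1; simpl. induction n as [|n IHn]; [reflexivity|].
    rewrite sumN_S, <- IHn; reflexivity.
  - rewrite sumN_S, IH, <- sumN_plus. apply sumN_ext; intros; now rewrite sumN_S.
Qed.

Lemma INR_sumN n f : INR (sumN n f) = sumR n (fun i => INR (f i)).
Proof.
  induction n as [|n IH]; [reflexivity|]. rewrite sumN_S, sumR_S, plus_INR, IH; lra.
Qed.

Lemma sumN_indicator n w :
  sumN n (fun v => Nat.b2n (v =? w)) = Nat.b2n (w <? n).
Proof.
  induction n as [|n IH]; [reflexivity|]. rewrite sumN_S, IH.
  destruct (Nat.eqb_spec n w), (Nat.ltb_spec w n), (Nat.ltb_spec w (S n)); simpl; lia.
Qed.

Lemma sumR_Cauchy_Schwarz n a b :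
  Rsqr (sumR n (fun i => a i * b i))
  <= sumR n (fun i => Rsqr (a i)) * sumR n (fun i => Rsqr (b i)).
Proof.
  set (p := sumR n (fun i => Rsqr (a i))). set (q := sumR n (fun i => Rsqr (b i))).
  set (r := sumR n (fun i => a i * b i)).
  assert (E : forall s t, 0 <= s * s * p - 2 * s * t * r + t * t * q).
  { intros s t.
    replace (s * s * p - 2 * s * t * r + t * t * q)
      with (sumR n (fun i => Rsqr (s * a i - t * b i))).
    - apply sumR_nonneg; intros; apply Rle_0_sqr.
    - unfold p, q, r.
      replace (s * s * sumR n (fun i => Rsqr (a i)) - 2 * s * t * sumR n (fun i => a i * b i)
               + t * t * sumR n (fun i => Rsqr (b i)))
        with (s * s * sumR n (fun i => Rsqr (a i)) + (- (2 * s * t)) * sumR n (fun i => a i * b i)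
               + t * t * sumR n (fun i => Rsqr (b i))) by ring.
      rewrite <- !sumR_scal, <- !sumR_plus. apply sumR_ext; intros; unfold Rsqr; ring. }
  assert (Hp : 0 <= p) by (apply sumR_nonneg; intros; apply Rle_0_sqr).
  assert (Hq : 0 <= q) by (apply sumR_nonneg; intros; apply Rle_0_sqr).
  unfold Rsqr. destruct (Rle_lt_or_eq_dec _ _ Hp) as [Hp'|Hp'].
  - generalize (E r p); intros E1.
    replace (r * r * p - 2 * r * p * r + p * p * q) with (p * (p * q - r * r)) in E1 by ring.
    apply Rminus_le, Ropp_le_cancel. rewrite Ropp_0, Ropp_minus_distr.
    apply (Rmult_le_reg_l p); [lra|]. rewrite Rmult_0_r; exact E1.
  (* For p = 0 the form at s = q + 1, t = r equals -r^2 (q + 2), which forces r = 0. *)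
  - generalize (E (q + 1) r); intros E1. rewrite <- Hp' in *. nra.
Qed.

(** * Bolzano-Weierstrass in finite dimension *)

(** The selection is only asked to satisfy [k <= psi k]: this already preserves limits, and it is
    stable under composition, as the induction on the dimension requires. *)
Lemma bolzano_weierstrass_seq (u : nat -> R) (K : R) :
  (forall k, Rabs (u k) <= K) ->
  exists (l : R) (psi : nat -> nat),
    (forall k, (k <= psi k)%nat) /\ (forall k, Rabs (u (psi k) - l) < / INR (S k)).
Proof.
  intros Hb.
  destruct (Bolzano_Weierstrass u (fun c => - K <= c <= K)) as [l Hl].
  - apply compact_P3.
  - intros k. specialize (Hb k). revert Hb. unfold Rabs; destruct Rcase_abs; lra.
  - exists l.
    destruct (functional_choice (fun k p => (k <= p)%nat /\ Rabs (u p - l) < / INR (S k))) as [psi Hpsi].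
    + intros k.
      assert (He : 0 < / INR (S k)) by (apply Rinv_0_lt_compat, lt_0_INR; lia).
      destruct (Hl (disc l (mkposreal _ He)) k) as [p [Hp Hd]].
      * exists (mkposreal _ He). intros y Hy; exact Hy.
      * exists p; split; [exact Hp|exact Hd].
    + exists psi; split; intros k; apply Hpsi.
Qed.

Lemma inv_INR_S_small (e : R) : 0 < e ->
  exists N, forall k, (N <= k)%nat -> / INR (S k) < e.
Proof.
  intros He. destruct (archimed_cor1 e He) as [N [HN HN0]]. exists N. intros k Hk.
  eapply Rle_lt_trans; [|exact HN]. apply Rinv_le_contravar.
  - now apply lt_0_INR.
  - apply le_INR; lia.
Qed.

Lemma bolzano_weierstrass_fin (n : nat) (x : nat -> nat -> R) (K : R) :
  (forall k i, (i < n)%nat -> Rabs (x k i) <= K) ->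
  exists (l : nat -> R) (psi : nat -> nat),
    (forall k, (k <= psi k)%nat) /\
    forall i, (i < n)%nat -> Un_cv (fun k => x (psi k) i) (l i).
Proof.
  revert x. induction n as [|n IH]; intros x Hb.
  - exists (fun _ => 0), (fun k => k). split; intros; lia.
  - destruct (bolzano_weierstrass_seq (fun k => x k n) K) as [ln [psi [Hpsi Hln]]].
    { intros k; apply Hb; lia. }
    destruct (IH (fun k => x (psi k))) as [l [phi [Hphi Hl]]].
    { intros k i Hi; apply Hb; lia. }
    exists (fun i => if Nat.eqb i n then ln else l i), (fun k => psi (phi k)). split.
    + intros k. specialize (Hphi k). specialize (Hpsi (phi k)). lia.
    + intros i Hi. destruct (Nat.eqb_spec i n) as [->|Hne]; [|apply Hl; lia].
      intros e He. destruct (inv_INR_S_small e He) as [N HN]. exists N. intros k Hk.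
      unfold Rdist. eapply Rlt_trans; [apply Hln|]. apply HN.
      specialize (Hphi k). lia.
Qed.

Lemma Un_cv_const (c : R) : Un_cv (fun _ => c) c.
Proof. intros e He. exists 0%nat. intros. unfold Rdist. rewrite Rminus_diag, Rabs_R0. lra. Qed.

Lemma Un_cv_sumR n (x : nat -> nat -> R) l :
  (forall i, (i < n)%nat -> Un_cv (fun k => x k i) (l i)) ->
  Un_cv (fun k => sumR n (x k)) (sumR n l).
Proof.
  induction n as [|n IH]; intros H; [exact (Un_cv_const 0)|].
  rewrite sumR_S.
  apply (Un_cv_ext (fun k => sumR n (x k) + x k n)); [intros; now rewrite sumR_S|].
  apply CV_plus; [apply IH|apply H]; auto with arith.
Qed.

(** * The averaging operator and its contraction on mean-zero functions *)

Definition sqnorm n (f : nat -> R) : R := sumR n (fun i => Rsqr (f i)).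
Definition inner n (f f' : nat -> R) : R := sumR n (fun i => f i * f' i).
Definition avg n d adj (f : nat -> R) (u : nat) : R :=
  sumR n (fun v => normA d adj u v * f v).

Lemma sqnorm_nonneg n f : 0 <= sqnorm n f.
Proof. apply sumR_nonneg; intros; apply Rle_0_sqr. Qed.

Lemma sqnorm_ext n f f' : (forall i, (i < n)%nat -> f i = f' i) -> sqnorm n f = sqnorm n f'.
Proof. intros H; apply sumR_ext; intros; now rewrite H. Qed.

Lemma sqnorm_scal n c f : sqnorm n (fun i => c * f i) = c * c * sqnorm n f.
Proof. unfold sqnorm. rewrite <- sumR_scal. apply sumR_ext; intros; unfold Rsqr; ring. Qed.

Lemma sqnorm_plus_scal n f c f' :
  sqnorm n (fun i => f i + c * f' i) = sqnorm n f + 2 * c * inner n f f' + c * c * sqnorm n f'.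
Proof.
  unfold sqnorm, inner. rewrite <- !sumR_scal, <- !sumR_plus.
  apply sumR_ext; intros; unfold Rsqr; ring.
Qed.

Lemma sqnorm_eq_0 n f : sqnorm n f = 0 -> forall i, (i < n)%nat -> f i = 0.
Proof.
  intros H i Hi. apply Rsqr_0_uniq.
  assert (Rsqr (f i) <= sqnorm n f).
  { apply (sumR_ge_term n (fun i => Rsqr (f i))); auto; intros; apply Rle_0_sqr. }
  generalize (Rle_0_sqr (f i)); lra.
Qed.

Lemma Rsqr_le_sqnorm n f i : (i < n)%nat -> Rsqr (f i) <= sqnorm n f.
Proof.
  intros Hi. apply (sumR_ge_term n (fun i => Rsqr (f i))); auto; intros; apply Rle_0_sqr.
Qed.

Lemma avg_ext n d adj f f' u :
  (forall i, (i < n)%nat -> f i = f' i) -> avg n d adj f u = avg n d adj f' u.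
Proof. intros H; apply sumR_ext; intros; now rewrite H. Qed.

Lemma avg_plus n d adj f f' u :
  avg n d adj (fun i => f i + f' i) u = avg n d adj f u + avg n d adj f' u.
Proof. unfold avg. rewrite <- sumR_plus. apply sumR_ext; intros; ring. Qed.

Lemma avg_scal n d adj c f u : avg n d adj (fun i => c * f i) u = c * avg n d adj f u.
Proof. unfold avg. rewrite <- sumR_scal. apply sumR_ext; intros; ring. Qed.

Lemma normA_sym n d adj u v : simple_graph n adj -> normA d adj u v = normA d adj v u.
Proof. intros [Hs _]. unfold normA. now rewrite Hs. Qed.

Lemma normA_nonneg d adj u v : (0 < d)%nat -> 0 <= normA d adj u v.
Proof.
  intros Hd. unfold normA. destruct (adj u v); [|lra].
  left; apply Rinv_0_lt_compat, lt_0_INR; lia.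
Qed.

Lemma avg_le n d adj f f' u : (0 < d)%nat ->
  (forall i, (i < n)%nat -> f i <= f' i) -> avg n d adj f u <= avg n d adj f' u.
Proof.
  intros Hd H. apply sumR_le; intros. apply Rmult_le_compat_l; auto using normA_nonneg.
Qed.

Lemma avg_selfadjoint n d adj f f' : simple_graph n adj ->
  inner n (avg n d adj f) f' = inner n f (avg n d adj f').
Proof.
  intros Hg. unfold inner, avg.
  rewrite (sumR_ext n _ (fun i => sumR n (fun j => normA d adj i j * f j * f' i)))
    by (intros; rewrite Rmult_comm, <- sumR_scal; apply sumR_ext; intros; ring).
  rewrite sumR_swap. apply sumR_ext; intros. rewrite <- sumR_scal.
  apply sumR_ext; intros. rewrite (normA_sym n d adj i i0) by assumption. ring.
Qed.

Lemma sum_normA n d adj u : (0 < d)%nat -> regular n d adj -> (u < n)%nat ->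
  sumR n (fun v => normA d adj u v) = 1.
Proof.
  intros Hd Hr Hu.
  rewrite (sumR_ext n _ (fun v => / INR d * INR (if adj u v then 1 else 0))).
  - rewrite sumR_scal, <- INR_sumN. specialize (Hr u Hu). unfold degree in Hr. rewrite Hr.
    apply Rinv_l, not_0_INR; lia.
  - intros; unfold normA; destruct (adj u i); simpl; lra.
Qed.

Lemma avg_const n d adj c u : (0 < d)%nat -> regular n d adj -> (u < n)%nat ->
  avg n d adj (fun _ => c) u = c.
Proof.
  intros. unfold avg.
  rewrite (sumR_ext n _ (fun v => c * normA d adj u v)) by (intros; ring).
  rewrite sumR_scal, sum_normA; auto; ring.
Qed.

Lemma sum_avg n d adj f : (0 < d)%nat -> simple_graph n adj -> regular n d adj ->
  sumR n (avg n d adj f) = sumR n f.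
Proof.
  intros Hd Hg Hr. unfold avg. rewrite sumR_swap. apply sumR_ext; intros v Hv.
  rewrite (sumR_ext n _ (fun u => f v * normA d adj v u))
    by (intros; rewrite (normA_sym n d adj i v) by assumption; ring).
  rewrite sumR_scal, sum_normA; auto; ring.
Qed.

(** * Extremal mean-zero functions and the operator norm *)

Lemma ex_sup_seq (X : R -> Prop) (M : R) :
  is_lub X M -> exists y : nat -> R, (forall k, X (y k)) /\ Un_cv y M.
Proof.
  intros [Hub Hl].
  destruct (functional_choice (fun k z => X z /\ M - / INR (S k) < z)) as [y Hy].
  - intros k. apply NNPP; intros Hn.
    assert (0 < / INR (S k)) by (apply Rinv_0_lt_compat, lt_0_INR; lia).
    assert (M <= M - / INR (S k)); [|lra].
    apply Hl. intros z Hz. apply Rnot_lt_le; intros Hlt. apply Hn. now exists z.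
  - exists y. split; [intros; apply Hy|].
    intros e He. destruct (inv_INR_S_small e He) as [N HN]. exists N. intros k Hk.
    specialize (HN k Hk). destruct (Hy k) as [HX Hlt]. specialize (Hub _ HX).
    unfold Rdist, Rabs; destruct Rcase_abs; lra.
Qed.

Lemma Un_cv_subseq (y : nat -> R) l psi :
  (forall k, (k <= psi k)%nat) -> Un_cv y l -> Un_cv (fun k => y (psi k)) l.
Proof.
  intros Hpsi Hy e He. destruct (Hy e He) as [N HN]. exists N. intros k Hk.
  apply HN. specialize (Hpsi k). lia.
Qed.

(** Compactness of the unit sphere of the mean-zero space: a maximizing sequence stays in a bounded
    box, and a coordinatewise limit keeps the sum, the norm and the value. Homogeneity extends the
    inequality from unit vectors to all mean-zero [f']. *)
Lemma ex_maximizer n d adj : (2 <= n)%nat -> (0 < d)%nat ->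
  exists f : nat -> R, sumR n f = 0 /\ sqnorm n f = 1 /\
    forall f', sumR n f' = 0 ->
      sqnorm n (avg n d adj f') <= sqnorm n (avg n d adj f) * sqnorm n f'.
Proof.
  intros Hn Hd.
  set (X := fun r => exists f, sumR n f = 0 /\ sqnorm n f = 1 /\ r = sqnorm n (avg n d adj f)).
  assert (Hbd : bound X).
  (* Cauchy-Schwarz row by row: the squared Hilbert-Schmidt norm of the matrix. *)
  { exists (sumR n (fun u => sqnorm n (fun v => normA d adj u v))).
    intros r [f [_ [Hf ->]]]. apply sumR_le; intros u Hu.
    eapply Rle_trans; [apply sumR_Cauchy_Schwarz|].
    change (sqnorm n (fun v => normA d adj u v) * sqnorm n f
            <= sqnorm n (fun v => normA d adj u v)). rewrite Hf; lra. }
  assert (Hne : exists r, X r).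
  (* Two opposite entries make a mean-zero unit vector; [2 <= n] enters here. *)
  { set (e := fun i : nat => match i with 0%nat => / sqrt 2 | 1%nat => - / sqrt 2 | _ => 0 end).
    exists (sqnorm n (avg n d adj e)), e.
    assert (Hs : forall (a : nat -> R) m, sumR (2 + m) a = a 0%nat + a 1%nat + sumR m (fun i => a (S (S i)))).
    { intros a m. simpl. rewrite !sumR_shift. lra. }
    replace n with (2 + (n - 2))%nat by lia.
    split; [|split; [|reflexivity]]; unfold sqnorm; rewrite Hs; simpl.
    - rewrite sumR_const. lra.
    - rewrite (sumR_ext _ _ (fun _ => 0)) by (intros; unfold Rsqr; ring).
      rewrite sumR_const. rewrite <- Rsqr_neg. rewrite Rsqr_inv', Rsqr_sqrt by lra. lra. }
  destruct (completeness X Hbd Hne) as [M HM].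
  destruct (ex_sup_seq X M HM) as [y [HyX Hy]].
  destruct (functional_choice (fun k f => sumR n f = 0 /\ sqnorm n f = 1 /\ y k = sqnorm n (avg n d adj f)) HyX)
    as [x Hx].
  destruct (bolzano_weierstrass_fin n x 1) as [f [psi [Hpsi Hf]]].
  { intros k i Hi. destruct (Hx k) as [_ [H1 _]].
    rewrite <- (Rabs_R1). apply Rsqr_le_abs_0.
    rewrite Rsqr_1, <- H1. now apply Rsqr_le_sqnorm. }
  assert (Hsq : forall (a : nat -> nat -> R) b,
    (forall i, (i < n)%nat -> Un_cv (fun k => a k i) (b i)) ->
    Un_cv (fun k => sqnorm n (a k)) (sqnorm n b)).
  { intros a b Hab. apply (Un_cv_sumR n (fun k i => Rsqr (a k i))).
    intros i Hi. unfold Rsqr. now apply CV_mult; apply Hab. }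
  assert (H0 : sumR n f = 0).
  { eapply UL_sequence; [apply Un_cv_sumR, Hf|].
    eapply Un_cv_ext; [|apply Un_cv_const]. intros k; simpl. symmetry; apply Hx. }
  assert (H1 : sqnorm n f = 1).
  { eapply UL_sequence; [apply Hsq, Hf|].
    eapply Un_cv_ext; [|apply Un_cv_const]. intros k; simpl. symmetry; apply Hx. }
  assert (H2 : sqnorm n (avg n d adj f) = M).
  { eapply UL_sequence; [apply (Hsq (fun k => avg n d adj (x (psi k))))|].
    - intros u Hu. apply (Un_cv_sumR n (fun k v => normA d adj u v * x (psi k) v)).
      intros v Hv. apply CV_mult; [apply Un_cv_const|now apply Hf].
    - apply (Un_cv_ext (fun k => y (psi k))); [intros k; apply Hx|].
      now apply Un_cv_subseq. }
  exists f. split; [exact H0|split; [exact H1|]]. rewrite H2.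
  intros f' Hf'. destruct (Rle_lt_or_eq_dec _ _ (sqnorm_nonneg n f')) as [Hp|Hz].
  - set (c := / sqrt (sqnorm n f')).
    assert (Hcc : c * c = / sqnorm n f').
    { unfold c. rewrite <- Rinv_mult, sqrt_sqrt; lra. }
    assert (Hle : sqnorm n (avg n d adj (fun i => c * f' i)) <= M).
    { apply HM. exists (fun i => c * f' i). split; [|split; [|reflexivity]].
      - rewrite sumR_scal, Hf'; ring.
      - rewrite sqnorm_scal, Hcc. field; lra. }
    rewrite (sqnorm_ext n _ (fun u => c * avg n d adj f' u)) in Hle
      by (intros; apply avg_scal).
    rewrite sqnorm_scal, Hcc in Hle.
    apply (Rmult_le_compat_r (sqnorm n f')) in Hle; [|lra].
    replace (/ sqnorm n f' * sqnorm n (avg n d adj f') * sqnorm n f')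
      with (sqnorm n (avg n d adj f')) in Hle by (field; lra). exact Hle.
  - symmetry in Hz. generalize (sqnorm_eq_0 n f' Hz); intros Hzero.
    rewrite (sqnorm_ext n _ (fun _ => 0)).
    + rewrite Hz. unfold sqnorm. rewrite sumR_const, Rsqr_0. lra.
    + intros u Hu. unfold avg. rewrite (sumR_ext n _ (fun _ => 0)).
      * rewrite sumR_const; ring.
      * intros i Hi; rewrite Hzero by assumption; ring.
Qed.

(** At e = -b/(c+1) the expression is -b^2 (1 + 1/(c+1)) / (c+1); the added 1 keeps the denominator
    positive even for c = 0. *)
Lemma quadratic_nonneg_linear_coef (b c : R) :
  0 <= c -> (forall e, 0 <= 2 * e * b + e * e * c) -> b = 0.
Proof.
  intros Hc H. specialize (H (- b * / (c + 1))).
  assert (Hi : 0 < / (c + 1)) by (apply Rinv_0_lt_compat; lra).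
  set (i := / (c + 1)) in *. assert (Hci : c * i = 1 - i) by (unfold i; field; lra).
  replace (2 * (- b * i) * b + - b * i * (- b * i) * c) with (b * b * i * (- 2 + c * i)) in H by ring.
  rewrite Hci in H. apply NNPP; intros Hb.
  assert (0 < b * b) by (apply Rsqr_pos_lt in Hb; exact Hb).
  assert (0 < b * b * i) by nra. nra.
Qed.

(* At a maximizer f of |Pf|^2 on the unit sphere of the mean-zero space, the first
   variation gives P^2 f = M f; then (P - sqrt M)(P + sqrt M) f = 0 exhibits
   sqrt M or - sqrt M as an eigenvalue. *)
Lemma spectral_contraction n d adj lam :
  (2 <= n)%nat -> (0 < d)%nat -> expander n d adj lam ->
  0 < lam /\
  forall f, sumR n f = 0 -> sqnorm n (avg n d adj f) <= lam * lam * sqnorm n f.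
Proof.
  intros Hn Hd [Hg [Hr [Hsp Hl]]].
  destruct (ex_maximizer n d adj Hn Hd) as [f [H0 [H1 Hmax]]].
  set (P := avg n d adj) in *. set (M := sqnorm n (P f)) in *.
  assert (HM : 0 <= M) by apply sqnorm_nonneg.
  assert (Hsum : forall a, sumR n (P a) = sumR n a) by (intros; now apply sum_avg).
  assert (Hvar : forall a, sumR n a = 0 -> M * inner n f a = inner n (P (P f)) a).
  { intros a Ha. apply Rminus_diag_uniq.
    apply (quadratic_nonneg_linear_coef _ (M * sqnorm n a - sqnorm n (P a))).
    - specialize (Hmax a Ha). lra.
    - intros e.
      assert (Hs : sumR n (fun i => f i + e * a i) = 0).
      { rewrite sumR_plus, sumR_scal, H0, Ha; ring. }
      specialize (Hmax _ Hs).
      rewrite (sqnorm_ext n (P _) (fun u => P f u + e * P a u)) in Hmax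
        by (intros; unfold P; now rewrite avg_plus, avg_scal).
      rewrite !sqnorm_plus_scal, H1 in Hmax. fold M in Hmax.
      replace (inner n (P (P f)) a) with (inner n (P f) (P a))
        by (symmetry; now apply avg_selfadjoint).
      lra. }
  assert (Heig : forall u, (u < n)%nat -> P (P f) u = M * f u).
  { set (a := fun i => M * f i + (-1) * P (P f) i).
    assert (Ha : sumR n a = 0).
    { unfold a. rewrite sumR_plus, !sumR_scal, !Hsum, H0; ring. }
    assert (Hz : sqnorm n a = 0).
    { specialize (Hvar a Ha).
      replace (sqnorm n a) with (M * inner n f a + (-1) * inner n (P (P f)) a); [lra|].
      unfold inner, sqnorm. rewrite <- !sumR_scal, <- sumR_plus.
      apply sumR_ext; intros; unfold a, Rsqr; ring. }
    intros u Hu. generalize (sqnorm_eq_0 n a Hz u Hu). unfold a. lra. }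
  set (mu := sqrt M). assert (Hmu : mu * mu = M) by (apply sqrt_sqrt; assumption).
  assert (Hmu0 : 0 <= mu) by apply sqrt_pos.
  assert (Hlt : mu < lam).
  { set (y := fun i => P f i + mu * f i).
    destruct (classic (exists v, (v < n)%nat /\ y v <> 0)) as [Hy|Hy].
    - rewrite <- (Rabs_right mu) by lra. apply (Hsp y mu).
      + unfold y. rewrite sumR_plus, sumR_scal, Hsum, H0; ring.
      + exact Hy.
      + intros u Hu. change (P y u = mu * y u). unfold y. unfold P at 1.
        rewrite avg_plus, avg_scal. fold P. rewrite Heig by assumption.
        rewrite <- Hmu; ring.
    - rewrite <- (Rabs_right mu), <- Rabs_Ropp by lra. apply (Hsp f (- mu)).
      + exact H0.
      + apply NNPP; intros Hno. assert (Hf0 : sqnorm n f = 0); [|lra].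
        rewrite (sqnorm_ext n f (fun _ => 0)).
        * unfold sqnorm. rewrite sumR_const, Rsqr_0; ring.
        * intros i Hi. apply NNPP; intros Hne. apply Hno; now exists i.
      + intros u Hu. change (P f u = - mu * f u).
        assert (y u = 0) by (apply NNPP; intros Hne; apply Hy; now exists u).
        unfold y in H. lra. }
  split; [lra|]. intros a Ha. specialize (Hmax a Ha).
  eapply Rle_trans; [exact Hmax|].
  apply Rmult_le_compat_r; [apply sqnorm_nonneg|]. nra.
Qed.

(** * Hitting times *)

(** Expectation of min(tau, k), with tau the hitting time of [S] by the simple random walk from
    [x]. *)
Fixpoint hit n d adj (S : nat -> bool) (k : nat) (x : nat) : R :=
  match k with
  | O => 0
  | Datatypes.S k' => if S x then 0 else 1 + avg n d adj (hit n d adj S k') x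
  end.

(** Probability that the walk from [x] avoids [S] at all times 0, ..., t. *)
Fixpoint survive n d adj (S : nat -> bool) (t : nat) (x : nat) : R :=
  match t with
  | O => if S x then 0 else 1
  | Datatypes.S t' => if S x then 0 else avg n d adj (survive n d adj S t') x
  end.

Fixpoint avg_iter n d adj (t : nat) (f : nat -> R) : nat -> R :=
  match t with
  | O => f
  | S t' => avg n d adj (avg_iter n d adj t' f)
  end.

Definition card n (S : nat -> bool) : R := sumR n (fun v => if S v then 1 else 0).

Lemma hit_sum_survive n d adj S k x :
  hit n d adj S k x = sumR k (fun t => survive n d adj S t x).
Proof.
  revert x. induction k as [|k IH]; intros x; [reflexivity|].
  rewrite sumR_shift. simpl. destruct (S x).
  - rewrite sumR_const; ring.
  - f_equal. unfold avg. rewrite sumR_swap. apply sumR_ext; intros v Hv.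
    now rewrite IH, sumR_scal.
Qed.

Lemma survive_nonneg n d adj S t x : (0 < d)%nat -> 0 <= survive n d adj S t x.
Proof.
  intros Hd. revert x. induction t as [|t IH]; intros x; simpl; destruct (S x); try lra.
  apply sumR_nonneg; intros. apply Rmult_le_pos; auto using normA_nonneg.
Qed.

Lemma hit_nonneg n d adj S k x : (0 < d)%nat -> 0 <= hit n d adj S k x.
Proof.
  intros Hd. rewrite hit_sum_survive. apply sumR_nonneg; intros; now apply survive_nonneg.
Qed.

Lemma survive_zero n d adj S t x : S x = true -> survive n d adj S t x = 0.
Proof. intros H; destruct t; simpl; now rewrite H. Qed.

Lemma survive_le_1 n d adj S t x :
  (0 < d)%nat -> regular n d adj -> (x < n)%nat -> survive n d adj S t x <= 1.
Proof.
  intros Hd Hr. revert x. induction t as [|t IH]; intros x Hx; simpl; destruct (S x); try lra.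
  rewrite <- (avg_const n d adj 1 x) by assumption. now apply avg_le.
Qed.

(** Visits to [S] during the first [t0] steps are ignored, so that the killed operator becomes the
    plain averaging operator there, to which mixing applies. *)
Lemma survive_le_avg_iter n d adj S t0 t x : (0 < d)%nat ->
  survive n d adj S (t0 + t) x <= avg_iter n d adj t0 (survive n d adj S t) x.
Proof.
  intros Hd. revert x. induction t0 as [|t0 IH]; intros x; [apply Rle_refl|].
  assert (H : avg n d adj (survive n d adj S (t0 + t)) x
              <= avg_iter n d adj (Datatypes.S t0) (survive n d adj S t) x)
    by (apply avg_le; auto).
  cbn [Nat.add survive]. destruct (S x); [|exact H].
  eapply Rle_trans; [|exact H].
  apply sumR_nonneg; intros. apply Rmult_le_pos; auto using normA_nonneg, survive_nonneg.
Qed.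

(** * Splitting off the mean *)

Definition mean n (f : nat -> R) : R := sumR n f / INR n.
Definition center n (f : nat -> R) (i : nat) : R := f i - mean n f.

Lemma sum_center n f : (0 < n)%nat -> sumR n (center n f) = 0.
Proof.
  intros Hn. unfold center.
  rewrite (sumR_ext n _ (fun i => f i + - mean n f)) by (intros; ring).
  rewrite sumR_plus, sumR_const. unfold mean. field. apply not_0_INR; lia.
Qed.

Lemma sqnorm_center n f : (0 < n)%nat ->
  sqnorm n (center n f) = sqnorm n f - INR n * Rsqr (mean n f).
Proof.
  intros Hn.
  rewrite (sqnorm_ext n (center n f) (fun i => f i + (- mean n f) * 1))
    by (intros; unfold center; ring).
  rewrite (sqnorm_plus_scal n f (- mean n f) (fun _ => 1)). unfold inner.
  rewrite (sumR_ext n (fun i => f i * 1) f) by (intros; ring).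
  unfold sqnorm at 2. rewrite sumR_const, Rsqr_1. unfold mean, Rsqr. field.
  apply not_0_INR; lia.
Qed.

Lemma avg_iter_center n d adj f t x :
  (0 < d)%nat -> regular n d adj -> (x < n)%nat ->
  avg_iter n d adj t f x = mean n f + avg_iter n d adj t (center n f) x.
Proof.
  intros Hd Hr. revert x. induction t as [|t IH]; intros x Hx; simpl.
  - unfold center; ring.
  - rewrite (avg_ext n d adj _ (fun i => mean n f + avg_iter n d adj t (center n f) i))
      by (intros; now apply IH).
    rewrite (avg_plus n d adj (fun _ => mean n f)), avg_const; auto.
Qed.

Lemma mean_sqr_le n f : (0 < n)%nat -> INR n * Rsqr (mean n f) <= sqnorm n f.
Proof.
  intros Hn. generalize (sqnorm_nonneg n (center n f)). rewrite sqnorm_center by assumption. lra.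
Qed.

(** Cauchy-Schwarz against the indicator of the complement of [S], where [f] is supported. *)
Lemma mean_sqr_le_card n S f : (0 < n)%nat ->
  (forall x, (x < n)%nat -> S x = true -> f x = 0) ->
  INR n * Rsqr (mean n f) <= (1 - card n S / INR n) * sqnorm n f.
Proof.
  intros Hn Hf. assert (Hn' : 0 < INR n) by now apply lt_0_INR.
  set (b := fun i => if S i then 0 else 1).
  assert (Hb : sumR n (fun i => Rsqr (b i)) = INR n - card n S).
  { replace (INR n) with (sumR n (fun _ => 1)) by (rewrite sumR_const; ring).
    unfold card.
    replace (sumR n (fun _ => 1) - sumR n (fun v => if S v then 1 else 0))
      with (sumR n (fun _ => 1) + (-1) * sumR n (fun v => if S v then 1 else 0)) by ring.
    rewrite <- sumR_scal, <- sumR_plus. apply sumR_ext; intros.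
    unfold b, Rsqr; destruct (S i); ring. }
  generalize (sumR_Cauchy_Schwarz n b f). rewrite Hb.
  rewrite (sumR_ext n (fun i => b i * f i) f).
  - fold (sqnorm n f). intros Hcs. unfold mean.
    replace (INR n * Rsqr (sumR n f / INR n)) with (Rsqr (sumR n f) / INR n)
      by (unfold Rsqr; field; lra).
    replace ((1 - card n S / INR n) * sqnorm n f)
      with ((INR n - card n S) * sqnorm n f / INR n) by (field; lra).
    apply Rmult_le_compat_r; [left; now apply Rinv_0_lt_compat|exact Hcs].
  - intros i Hi. unfold b. destruct (S i) eqn:E; [rewrite Hf by assumption|]; ring.
Qed.

Lemma card_le n S : card n S <= INR n.
Proof.
  replace (INR n) with (sumR n (fun _ => 1)) by (rewrite sumR_const; ring).
  apply sumR_le; intros; destruct (S i); lra.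
Qed.

Lemma card_nonneg n S : 0 <= card n S.
Proof. apply sumR_nonneg; intros; destruct (S i); lra. Qed.

Lemma geometric_sum_le (r : R) (k : nat) : 0 <= r < 1 -> sumR k (fun t => r ^ t) <= / (1 - r).
Proof.
  intros Hr1. assert (H : (1 - r) * sumR k (fun t => r ^ t) = 1 - r ^ k).
  { induction k as [|k IH]; [unfold sumR; simpl; ring|]. rewrite sumR_S, Rmult_plus_distr_l, IH; simpl; ring. }
  apply Rmult_le_reg_l with (1 - r); [lra|]. rewrite H, Rinv_r by lra.
  assert (0 <= r ^ k) by (apply pow_le; lra). lra.
Qed.

Lemma ln_le_mono (x y : R) : 0 < x -> x <= y -> ln x <= ln y.
Proof.
  intros Hx [Hlt| ->]; [left; now apply ln_increasing|apply Rle_refl].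
Qed.

Lemma exp_le_mono (x y : R) : x <= y -> exp x <= exp y.
Proof. intros [Hlt| ->]; [left; now apply exp_increasing|apply Rle_refl]. Qed.

Lemma exp_mul_INR (x : R) (k : nat) : exp (INR k * x) = exp x ^ k.
Proof.
  induction k as [|k IH]; [simpl; now rewrite Rmult_0_l, exp_0|].
  rewrite S_INR, Rmult_plus_distr_r, Rmult_1_l, exp_plus, IH; simpl; ring.
Qed.

Lemma ln_ge_half (m : nat) : (2 <= m)%nat -> / 2 <= ln (INR m).
Proof.
  intros Hm. apply Rle_trans with (ln 2); [left; exact ln_lt_2|].
  apply ln_le_mono; [lra|]. change 2 with (INR 2). now apply le_INR.
Qed.

Section Hitting.
Variables (n d : nat) (adj : nat -> nat -> bool) (lam : R).
Hypotheses (Hn : (2 <= n)%nat) (Hd : (0 < d)%nat) (Hexp : expander n d adj lam).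

Let Hn0 : (0 < n)%nat. Proof. lia. Qed.
Let HnR : 0 < INR n. Proof. now apply lt_0_INR. Qed.
Let Hg : simple_graph n adj. Proof. apply Hexp. Qed.
Let Hr : regular n d adj. Proof. apply Hexp. Qed.
Let Hlam1 : lam < 1. Proof. apply Hexp. Qed.
Let Hlam0 : 0 < lam. Proof. now apply (spectral_contraction n d adj lam). Qed.

Lemma sum_avg_iter t f : sumR n (avg_iter n d adj t f) = sumR n f.
Proof.
  induction t as [|t IH]; [reflexivity|]. simpl. rewrite sum_avg by assumption. exact IH.
Qed.

Lemma sqnorm_avg_iter t f : sumR n f = 0 ->
  sqnorm n (avg_iter n d adj t f) <= (lam * lam) ^ t * sqnorm n f.
Proof.
  intros Hf. induction t as [|t IH]; simpl; [lra|].
  eapply Rle_trans.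
  - apply (spectral_contraction n d adj lam); auto. now rewrite sum_avg_iter.
  - rewrite (Rmult_assoc (lam * lam)). apply Rmult_le_compat_l; [nra|exact IH].
Qed.

(** Averaging preserves the mean and shrinks the squared norm of the centred part by lam^2. With q
    the density of [S], the mean carries at most the share 1 - q of the squared norm, so the total
    factor is at most 1 - (1 - lam^2) q; then lam^2 <= lam. *)
Lemma sqnorm_avg_supported S f :
  (forall x, (x < n)%nat -> S x = true -> f x = 0) ->
  sqnorm n (avg n d adj f) <= (1 - (1 - lam) * (card n S / INR n)) * sqnorm n f.
Proof.
  intros Hf. set (P := avg n d adj).
  assert (Hmean : mean n (P f) = mean n f).
  { unfold mean, P. now rewrite sum_avg. }
  assert (Hc : sqnorm n (center n (P f)) <= lam * lam * sqnorm n (center n f)).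
  { rewrite (sqnorm_ext n (center n (P f)) (P (center n f))).
    - apply (spectral_contraction n d adj lam); auto. now apply sum_center.
    - intros i Hi. unfold center at 1. rewrite Hmean. unfold P.
      generalize (avg_iter_center n d adj f 1 i Hd Hr Hi); simpl; lra. }
  rewrite !sqnorm_center, Hmean in Hc by assumption.
  generalize (mean_sqr_le_card n S f Hn0 Hf); intros Hm.
  set (q := card n S / INR n) in *.
  assert (Hq0 : 0 <= q) by (apply Rmult_le_pos; [apply card_nonneg|left; now apply Rinv_0_lt_compat]).
  generalize (sqnorm_nonneg n f); intros Hf0.
  set (N := sqnorm n f) in *. set (m := INR n * Rsqr (mean n f)) in *.
  assert (H1 : (1 - lam * lam) * m <= (1 - lam * lam) * ((1 - q) * N))
    by (apply Rmult_le_compat_l; [nra|exact Hm]).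
  assert (H2 : (lam - lam * lam) * (q * N) >= 0).
  { apply Rle_ge, Rmult_le_pos; [nra|now apply Rmult_le_pos]. }
  nra.
Qed.

Lemma sqnorm_survive S t :
  sqnorm n (survive n d adj S t)
  <= ((1 - (1 - lam) * (card n S / INR n) / 2) ^ t) ^ 2 * INR n.
Proof.
  set (q := card n S / INR n).
  assert (Hq0 : 0 <= q) by (apply Rmult_le_pos; [apply card_nonneg|left; now apply Rinv_0_lt_compat]).
  set (rho := 1 - (1 - lam) * q / 2).
  induction t as [|t IH].
  - simpl. replace (1 * (1 * 1) * INR n) with (sumR n (fun _ => 1)) by (rewrite sumR_const; ring).
    apply sumR_le; intros; simpl; destruct (S i); unfold Rsqr; lra.
  - apply Rle_trans with (sqnorm n (avg n d adj (survive n d adj S t))).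
    { apply sumR_le; intros; simpl; destruct (S i); [rewrite Rsqr_0; apply Rle_0_sqr|lra]. }
    eapply Rle_trans.
    { apply (sqnorm_avg_supported S). intros; now apply survive_zero. }
    (* The factor is put in square form by 1 - y <= (1 - y/2)^2, whence the 2 in [rho]. *)
    fold q. apply Rle_trans with (rho ^ 2 * sqnorm n (survive n d adj S t)).
    + apply Rmult_le_compat_r; [apply sqnorm_nonneg|].
      generalize (Rle_0_sqr ((1 - lam) * q / 2)). unfold rho, Rsqr. simpl. lra.
    + replace ((rho ^ Datatypes.S t) ^ 2 * INR n) with (rho ^ 2 * ((rho ^ t) ^ 2 * INR n)) by (simpl; ring).
      apply Rmult_le_compat_l; [apply pow2_ge_0|exact IH].
Qed.

(** After [t0] free steps the value at a vertex is the mean of [survive t] plus a centred remainder.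
    The mean is at most the root mean square, hence at most rho^t. Passing from the root mean square
    to a single point costs a factor sqrt n, which the [t0] mixing steps pay for, so the remainder
    is at most rho^t as well. *)
Lemma survive_after_mixing S t0 t x :
  INR n * (lam * lam) ^ t0 <= 1 -> (x < n)%nat ->
  survive n d adj S (t0 + t) x <= 2 * (1 - (1 - lam) * (card n S / INR n) / 2) ^ t.
Proof.
  intros Ht0 Hx. generalize (sqnorm_survive S t). set (rho := 1 - _).
  set (f := survive n d adj S t). intros Hf.
  assert (Hrho : 0 <= rho).
  { unfold rho. assert (card n S / INR n <= 1).
    { apply Rmult_le_reg_r with (INR n); [exact HnR|]. unfold Rdiv.
      rewrite Rmult_assoc, Rinv_l, Rmult_1_r, Rmult_1_l by lra. apply card_le. }
    assert (0 <= card n S / INR n) by (apply Rmult_le_pos; [apply card_nonneg|left; now apply Rinv_0_lt_compat]).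
    nra. }
  assert (Hpow : 0 <= rho ^ t) by now apply pow_le.
  assert (Hsq : forall y, INR n * Rsqr y <= sqnorm n f -> y <= rho ^ t).
  { intros y Hy. apply Rsqr_incr_0_var; [|exact Hpow].
    apply Rmult_le_reg_l with (INR n); [exact HnR|].
    eapply Rle_trans; [exact Hy|]. eapply Rle_trans; [exact Hf|]. unfold Rsqr; simpl; lra. }
  eapply Rle_trans; [apply survive_le_avg_iter; exact Hd|]. fold f.
  rewrite avg_iter_center by assumption.
  assert (mean n f <= rho ^ t) by (apply Hsq, mean_sqr_le; exact Hn0).
  assert (avg_iter n d adj t0 (center n f) x <= rho ^ t); [|lra].
  apply Hsq.
  assert (H1 : Rsqr (avg_iter n d adj t0 (center n f) x) <= (lam * lam) ^ t0 * sqnorm n f).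
  { eapply Rle_trans; [apply Rsqr_le_sqnorm; exact Hx|].
    eapply Rle_trans; [apply sqnorm_avg_iter, sum_center, Hn0|].
    apply Rmult_le_compat_l; [apply pow_le; nra|].
    rewrite sqnorm_center by assumption. 
    assert (0 <= INR n * Rsqr (mean n f)) by (apply Rmult_le_pos; [lra|apply Rle_0_sqr]). lra. }
  generalize (sqnorm_nonneg n f); intros.
  apply Rle_trans with (INR n * ((lam * lam) ^ t0 * sqnorm n f));
    [apply Rmult_le_compat_l; lra|].
  rewrite <- Rmult_assoc. rewrite <- (Rmult_1_l (sqnorm n f)) at 2.
  apply Rmult_le_compat_r; lra.
Qed.

Lemma mixing_time_bound :
  exists t0, INR n * (lam * lam) ^ t0 <= 1 /\ INR t0 <= 3 * ln (INR n) / (1 - lam).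
Proof.
  assert (Hln : / 2 <= ln (INR n)) by now apply ln_ge_half.
  set (a := ln (INR n) / (1 - lam)).
  assert (Ha : ln (INR n) <= a).
  { unfold a. apply Rmult_le_reg_r with (1 - lam); [lra|].
    unfold Rdiv. rewrite Rmult_assoc, Rinv_l by lra. nra. }
  exists (Z.to_nat (up a)). destruct (archimed a) as [Hup1 Hup2].
  assert (Hz : (0 <= up a)%Z) by (apply le_IZR; lra).
  assert (HI : INR (Z.to_nat (up a)) = IZR (up a)) by (rewrite INR_IZR_INZ, Z2Nat.id; auto).
  split.
  - set (t0 := Z.to_nat (up a)) in *.
    (* lam <= exp (lam - 1), and lam^2 <= lam because 0 < lam < 1. *)
    assert (H1 : lam * lam <= exp (- (1 - lam))).
    { generalize (exp_ineq1_le (- (1 - lam))). nra. }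
    assert (H2 : (lam * lam) ^ t0 <= exp (- (1 - lam)) ^ t0) by (apply pow_incr; nra).
    rewrite <- exp_mul_INR in H2.
    assert (H3 : exp (INR t0 * - (1 - lam)) <= / INR n).
    { rewrite <- (exp_ln (INR n)) by assumption. rewrite <- exp_Ropp.
      apply exp_le_mono. assert (Haa : ln (INR n) = a * (1 - lam)) by (unfold a; field; lra).
      rewrite Haa, HI. nra. }
    apply Rmult_le_reg_l with (/ INR n); [now apply Rinv_0_lt_compat|].
    rewrite <- Rmult_assoc, Rinv_l, Rmult_1_r, Rmult_1_l by lra. lra.
  (* Rounding: up a <= a + 1 <= 3 a, as a >= ln n >= 1/2. *)
  - rewrite HI. replace (3 * ln (INR n) / (1 - lam)) with (3 * a) by (unfold a; field; lra). lra.
Qed.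

(** The expectation is the sum of the survival probabilities: the first [t0] are bounded by 1, the
    later ones by 2 rho^t with 1 - rho = (1 - lam) |S| / (2n), whence the 4. *)
Lemma hit_bound S k x : 0 < card n S -> (x < n)%nat ->
  hit n d adj S k x <= 4 * INR n / ((1 - lam) * card n S) + 3 * ln (INR n) / (1 - lam).
Proof.
  intros HS Hx. destruct mixing_time_bound as [t0 [Ht0 Ht0']].
  rewrite hit_sum_survive.
  set (rho := 1 - (1 - lam) * (card n S / INR n) / 2).
  assert (Hq : 0 < card n S / INR n) by now apply Rdiv_lt_0_compat.
  assert (Hq1 : card n S / INR n <= 1).
  { apply Rmult_le_reg_r with (INR n); [exact HnR|]. unfold Rdiv.
    rewrite Rmult_assoc, Rinv_l, Rmult_1_r, Rmult_1_l by lra. apply card_le. }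
  assert (Hrho : 0 <= rho < 1) by (unfold rho; split; nra).
  assert (Hle : forall j, sumR (t0 + j) (fun t => survive n d adj S t x)
                <= INR t0 + sumR j (fun t => 2 * rho ^ t)).
  { induction j as [|j IH].
    - rewrite Nat.add_0_r. replace (sumR 0 (fun t => 2 * rho ^ t)) with 0 by reflexivity.
      replace (INR t0 + 0) with (sumR t0 (fun _ => 1)) by (rewrite sumR_const; ring).
      apply sumR_le; intros; now apply survive_le_1.
    - rewrite Nat.add_succ_r, !sumR_S.
      generalize (survive_after_mixing S t0 j x Ht0 Hx). fold rho. lra. }
  (* The terms are nonnegative; lengthening the range by [t0] avoids comparing [k] with [t0]. *)
  assert (Hmono : sumR k (fun t => survive n d adj S t x)
                  <= sumR (t0 + k) (fun t => survive n d adj S t x)).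
  { clear Ht0 Ht0' Hle. induction t0 as [|t0 IH]; [simpl; lra|].
    simpl. rewrite sumR_S. generalize (survive_nonneg n d adj S (t0 + k) x Hd). lra. }
  specialize (Hle k). rewrite (sumR_scal k 2 (fun t => rho ^ t)) in Hle.
  generalize (geometric_sum_le rho k Hrho); intros Hgeo.
  replace (/ (1 - rho)) with (2 * INR n / ((1 - lam) * card n S)) in Hgeo
    by (replace (1 - rho) with ((1 - lam) * card n S / (2 * INR n)) by (unfold rho; field; lra);
        field; repeat split; lra).
  replace (4 * INR n / ((1 - lam) * card n S)) with (2 * (2 * INR n / ((1 - lam) * card n S)))
    by (field; split; lra).
  lra.
Qed.
End Hitting.

(** * Even subgraphs and non-backtracking trails *)

Definition vol n (E : nat -> nat -> bool) : nat := sumN n (degree n E).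

(** The test mirrors the one in [used], so that [unused_snoc] is an equality of boolean
    functions. *)
Definition remove_edge (E : nat -> nat -> bool) (x w u v : nat) : bool :=
  E u v && negb ((Nat.eqb x u && Nat.eqb w v) || (Nat.eqb x v && Nat.eqb w u)).

(* Along a trail from s to x in an initially even graph, the vertices of odd
   remaining degree are exactly s and x (none if s = x). *)
Definition parity n (E : nat -> nat -> bool) (s x : nat) : Prop :=
  forall v, (v < n)%nat -> Nat.odd (degree n E v) = xorb (v =? s) (v =? x).

(* The walk is listed with its current endpoint first. *)
Fixpoint nonbacktracking (adj : nat -> nat -> bool) (p : list nat) : Prop :=
  match p with
  | a :: ((b :: t) as p') =>
      adj b a = true /\ match t with c :: _ => a <> c | [] => True end
      /\ nonbacktracking adj p'
  | _ => True
  end.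

Lemma degree_pos n E u v : (v < n)%nat -> E u v = true -> (0 < degree n E u)%nat.
Proof.
  intros Hv HE. unfold degree.
  generalize (sumN_ge_term n (fun v => if E u v then 1 else 0)%nat v Hv). simpl. rewrite HE. lia.
Qed.

Lemma degree_le n E E' u : (forall v, E u v = true -> E' u v = true) ->
  (degree n E u <= degree n E' u)%nat.
Proof.
  intros H. apply sumN_le; intros v Hv. specialize (H v).
  destruct (E u v); [rewrite H by reflexivity|]; lia.
Qed.

Lemma vol_pos_edge n E : (0 < vol n E)%nat ->
  exists u v, (u < n)%nat /\ (v < n)%nat /\ E u v = true.
Proof.
  assert (Hex : forall m f, (0 < sumN m f)%nat -> exists i, (i < m)%nat /\ (0 < f i)%nat).
  { induction m as [|m IH]; intros f Hf; [inversion Hf|]. rewrite sumN_S in Hf.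
    destruct (Nat.eq_dec (f m) 0) as [H0|H0].
    - destruct (IH f) as [i [Hi Hfi]]; [lia|]. exists i; split; [lia|exact Hfi].
    - exists m; split; lia. }
  intros H. destruct (Hex _ _ H) as [u [Hu Hdu]]. destruct (Hex _ _ Hdu) as [v [Hv Hv']].
  exists u, v. destruct (E u v); [auto|inversion Hv'].
Qed.

Lemma edge_vol_pos n E u v : (u < n)%nat -> (v < n)%nat -> E u v = true -> (0 < vol n E)%nat.
Proof.
  intros Hu Hv HE. generalize (sumN_ge_term n (degree n E) u Hu) (degree_pos n E u v Hv HE).
  unfold vol. lia.
Qed.

Lemma degree_remove_edge n E x w u :
  (forall a b, E a b = E b a) -> x <> w -> (x < n)%nat -> (w < n)%nat -> E x w = true ->
  (degree n (remove_edge E x w) u + (Nat.b2n (u =? x) + Nat.b2n (u =? w)) = degree n E u)%nat.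
Proof.
  intros Hsym Hne Hx Hw HE. unfold degree.
  rewrite (sumN_ext n (fun v => if E u v then 1 else 0)%nat
    (fun v => (if remove_edge E x w u v then 1 else 0)
              + ((if u =? x then Nat.b2n (v =? w) else 0)
                 + (if u =? w then Nat.b2n (v =? x) else 0)))%nat).
  - rewrite !sumN_plus. f_equal. f_equal.
    + destruct (u =? x).
      * rewrite sumN_indicator. apply Nat.ltb_lt in Hw. now rewrite Hw.
      * clear. induction n as [|n IH]; [reflexivity|]. now rewrite sumN_S, <- IH.
    + destruct (u =? w).
      * rewrite sumN_indicator. apply Nat.ltb_lt in Hx. now rewrite Hx.
      * clear. induction n as [|n IH]; [reflexivity|]. now rewrite sumN_S, <- IH.
  - intros v Hv. unfold remove_edge.
    destruct (Nat.eqb_spec u x) as [->|Hux], (Nat.eqb_spec v w) as [->|Hvw];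
    rewrite ?Nat.eqb_refl.
    + rewrite HE. apply Nat.eqb_neq in Hne. rewrite Hne. reflexivity.
    + destruct (Nat.eqb_spec w v); [congruence|]. destruct (Nat.eqb_spec x w); [congruence|].
      rewrite (proj2 (Nat.eqb_neq w x)) by congruence.
      destruct (x =? v); destruct (E x v); reflexivity.
    + rewrite (proj2 (Nat.eqb_neq x u)), (proj2 (Nat.eqb_neq x w)), (proj2 (Nat.eqb_neq w x)) by congruence.
      simpl. destruct (E u w), (u =? w); reflexivity.
    + rewrite (proj2 (Nat.eqb_neq x u)) by congruence. simpl.
      rewrite (Nat.eqb_sym x v), (Nat.eqb_sym w u).
      destruct (Nat.eqb_spec u w) as [->|], (Nat.eqb_spec v x) as [->|];
        try rewrite (Hsym w x), HE; try (destruct (E u v)); try (destruct (E w v)); try (destruct (E u x)); reflexivity.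
Qed.

Lemma vol_remove_edge n E x w :
  (forall a b, E a b = E b a) -> x <> w -> (x < n)%nat -> (w < n)%nat -> E x w = true ->
  (vol n (remove_edge E x w) + 2 = vol n E)%nat.
Proof.
  intros Hsym Hne Hx Hw HE. unfold vol.
  rewrite (sumN_ext n (degree n E) (fun u => degree n (remove_edge E x w) u
     + (Nat.b2n (u =? x) + Nat.b2n (u =? w)))%nat)
    by (intros; symmetry; now apply degree_remove_edge).
  rewrite !sumN_plus, !sumN_indicator.
  apply Nat.ltb_lt in Hx, Hw. rewrite Hx, Hw. reflexivity.
Qed.

Lemma parity_remove_edge n E s x w :
  (forall a b, E a b = E b a) -> x <> w -> (x < n)%nat -> (w < n)%nat -> E x w = true ->
  parity n E s x -> parity n (remove_edge E x w) s w.
Proof.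
  intros Hsym Hne Hx Hw HE Hp v Hv. specialize (Hp v Hv).
  rewrite <- (degree_remove_edge n E x w v) in Hp by assumption.
  rewrite !Nat.odd_add in Hp. revert Hp.
  destruct (Nat.odd (degree n (remove_edge E x w) v)), (v =? x), (v =? s), (v =? w);
    simpl; intros Hp; (reflexivity || discriminate Hp).
Qed.

Lemma remove_edge_sym E x w :
  (forall a b, E a b = E b a) -> forall a b, remove_edge E x w a b = remove_edge E x w b a.
Proof.
  intros Hsym a b. unfold remove_edge. rewrite (Hsym a b).
  destruct (E b a), (x =? a), (w =? b), (x =? b), (w =? a); reflexivity.
Qed.

Lemma remove_edge_sub E x w u v : remove_edge E x w u v = true -> E u v = true.
Proof. unfold remove_edge. intros H. now apply andb_prop in H. Qed.

Lemma remove_edge_absent E x w :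
  (forall a b, E a b = E b a) -> E x w = false -> remove_edge E x w = E.
Proof.
  intros Hsym H. extensionality u; extensionality v. unfold remove_edge.
  destruct (E u v) eqn:Huv; [|reflexivity]. assert (Hvu : E v u = true) by (now rewrite Hsym).
  destruct (Nat.eqb_spec x u), (Nat.eqb_spec w v), (Nat.eqb_spec x v), (Nat.eqb_spec w u);
    try reflexivity; congruence.
Qed.

(** * Closed trails and girth *)

Lemma nonbacktracking_nth adj p i : nonbacktracking adj p -> (S i < length p)%nat ->
  adj (nth (S i) p 0%nat) (nth i p 0%nat) = true.
Proof.
  revert i. induction p as [|a [|b t] IH]; intros i Hp Hi; simpl in Hi; [lia|lia|].
  destruct Hp as [Hab [_ Hp]]. destruct i as [|i]; [exact Hab|].
  apply (IH i Hp). simpl; lia.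
Qed.

Lemma last_nth_length (l : list nat) : l <> [] -> last l 0%nat = nth (length l - 1) l 0%nat.
Proof.
  intros Hl. destruct (exists_last Hl) as [l' [a ->]].
  rewrite last_last, length_app, app_nth2; simpl; [|lia].
  replace (length l' + 1 - 1 - length l')%nat with 0%nat by lia. reflexivity.
Qed.

(** Strip entries from the head until the rest is free of repetitions: the last stripped vertex [a]
    recurs in it, and the segment up to the recurrence is a cycle. Irreflexivity excludes length 1,
    non-backtracking excludes length 2. The second occurrence of [a] accounts for the successor in
    [S g]. *)
Lemma nonbacktracking_repeat_length adj g p :
  (forall u v, adj u v = adj v u) -> (forall u, adj u u = false) ->
  (forall c, is_cycle adj c -> (g <= length c)%nat) ->
  nonbacktracking adj p -> ~ NoDup p -> (S g <= length p)%nat.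
Proof.
  intros Hsym Hirr Hg. induction p as [|a p IH]; intros Hp Hnd; [exfalso; apply Hnd; constructor|].
  assert (Hp' : nonbacktracking adj p) by (destruct p; simpl in *; tauto).
  destruct (classic (NoDup p)) as [Hnp|Hnp]; [|specialize (IH Hp' Hnp); simpl; lia].
  assert (Ha : In a p) by (apply NNPP; intros Ha; apply Hnd; now constructor).
  destruct (in_split _ _ Ha) as [l1 [l2 ->]].
  assert (Hc : is_cycle adj (a :: l1)).
  { assert (Hedge : forall i, (i <= length l1)%nat ->
      adj (nth (S i) (a :: l1 ++ a :: l2) 0%nat) (nth i (a :: l1 ++ a :: l2) 0%nat) = true).
    { intros i Hi. apply nonbacktracking_nth; [exact Hp|]. simpl. rewrite length_app; simpl; lia. }
    repeat split.
    - destruct l1 as [|b [|b' l1]]; simpl in *; [|destruct Hp as [_ [Hp _]]; congruence|lia].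
      destruct Hp as [Hp _]. rewrite Hirr in Hp. discriminate.
    - constructor.
      + intros Hin. apply NoDup_remove_2 in Hnp. apply Hnp. apply in_or_app; now left.
      + apply NoDup_remove_1 in Hnp. clear -Hnp.
        induction l1 as [|b l1 IH]; [constructor|]. inversion Hnp; subst. constructor; auto.
        intros H; apply H1, in_or_app; now left.
    - intros i Hi. rewrite Hsym. specialize (Hedge i ltac:(simpl in Hi; lia)).
      rewrite !app_comm_cons in Hedge. rewrite !app_nth1 in Hedge by lia. exact Hedge.
    - rewrite last_nth_length by discriminate. rewrite Hsym.
      specialize (Hedge (length l1) (le_n _)). rewrite !app_comm_cons in Hedge.
      rewrite app_nth2 in Hedge by (simpl; lia). rewrite app_nth1 in Hedge by (simpl; lia).
      simpl length in *. replace (S (length l1) - S (length l1))%nat with 0%nat in Hedge by lia.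
      replace (S (length l1) - 1)%nat with (length l1) by lia. exact Hedge. }
  specialize (Hg _ Hc). simpl in *. rewrite length_app; simpl; lia.
Qed.

(** [E] is what the trail has left over. The third clause says that the edge just traversed is gone
    from [E]; this is what keeps the next step from backtracking. *)
Definition on_trail n adj (E : nat -> nat -> bool) (p : list nat) (s : nat) : Prop :=
  nonbacktracking adj p /\ last p 0%nat = s /\
  match p with a :: b :: _ => E a b = false | _ => True end /\
  parity n E s (hd 0%nat p).

Section Trails.
Variables (n g : nat) (adj : nat -> nat -> bool).
Hypotheses (Hgr : simple_graph n adj)
  (Hgirth : forall c, is_cycle adj c -> (g <= length c)%nat).

Definition sub_relation (E : nat -> nat -> bool) : Prop :=
  (forall a b, E a b = E b a) /\ forall a b, E a b = true -> adj a b = true.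

Lemma sub_relation_facts E x w : sub_relation E -> E x w = true ->
  x <> w /\ (x < n)%nat /\ (w < n)%nat.
Proof.
  intros [Hsym Hsub] HE. destruct Hgr as [_ [Hirr Hlt]]. apply Hsub in HE.
  split; [intros ->; rewrite Hirr in HE; discriminate|now apply Hlt].
Qed.

Lemma on_trail_step E x p s w : sub_relation E ->
  on_trail n adj E (x :: p) s -> E x w = true ->
  on_trail n adj (remove_edge E x w) (w :: x :: p) s.
Proof.
  intros HE [Hnb [Hlast [Hprev Hpar]]] Hxw.
  destruct (sub_relation_facts E x w HE Hxw) as [Hne [Hx Hw]]. destruct HE as [Hsym Hsub].
  split; [|split; [|split]].
  - change (adj x w = true /\ match p with c :: _ => w <> c | [] => True end
            /\ nonbacktracking adj (x :: p)).
    split; [now apply Hsub|split; [|exact Hnb]].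
    destruct p as [|c p]; [exact I|]. intros ->. congruence.
  - exact Hlast.
  - unfold remove_edge. rewrite !Nat.eqb_refl. simpl. now rewrite orb_true_r, andb_false_r.
  - now apply parity_remove_edge.
Qed.

(** Degree 0 is even, whereas parity makes an endpoint other than [s] odd. So the trail is back at
    its origin, its vertex list repeats, and the girth bound applies. *)
Lemma on_trail_stuck E x p s : (x < n)%nat -> on_trail n adj E (x :: p) s -> p <> [] ->
  degree n E x = 0%nat -> s = x /\ (g <= length p)%nat.
Proof.
  intros Hx [Hnb [Hlast [Hprev Hpar]]] Hp Hd. specialize (Hpar x Hx). simpl in Hpar.
  rewrite Hd, Nat.eqb_refl in Hpar.
  assert (Hs : s = x) by (destruct (Nat.eqb_spec x s); [auto|discriminate]).
  split; [exact Hs|]. destruct Hgr as [Hsym [Hirr _]].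
  assert (H : (S g <= length (x :: p))%nat); [|simpl in H; lia].
  apply (nonbacktracking_repeat_length adj g); auto.
  intros Hnd. rewrite Hs in Hlast. inversion_clear Hnd as [|? ? Hnin]. apply Hnin. rewrite <- Hlast.
  destruct (exists_last Hp) as [q [a ->]].
  rewrite app_comm_cons, last_last. apply in_or_app; right; now left.
Qed.

(* Extend the trail arbitrarily: by parity it can only get stuck at its origin,
   and it is then a closed trail. *)
Lemma on_trail_vol_ge E x p s : sub_relation E -> (x < n)%nat ->
  on_trail n adj E (x :: p) s -> p <> [] -> (2 * g <= vol n E + 2 * length p)%nat.
Proof.
  remember (vol n E) as m eqn:Hm. revert E x p Hm.
  induction m as [m IH] using lt_wf_ind. intros E x p Hm HE Hx Ht Hp.
  destruct (Nat.eq_dec (degree n E x) 0) as [H0|H0].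
  - destruct (on_trail_stuck E x p s Hx Ht Hp H0). lia.
  - assert (Hex : exists w, E x w = true).
    { apply NNPP; intros Hno. apply H0. unfold degree.
      rewrite (sumN_ext n _ (fun _ => 0%nat)).
      - clear. induction n as [|k IH]; [reflexivity|]. now rewrite sumN_S, IH.
      - intros v Hv. destruct (E x v) eqn:Ev; [exfalso; apply Hno; now exists v|reflexivity]. }
    destruct Hex as [w Hw]. destruct (sub_relation_facts E x w HE Hw) as [Hne [_ Hwn]].
    assert (Hv : (vol n (remove_edge E x w) + 2 = vol n E)%nat) by (apply vol_remove_edge; auto; apply HE).
    specialize (IH (vol n (remove_edge E x w)) ltac:(lia) (remove_edge E x w) w (x :: p) eq_refl).
    simpl length in IH. enough (2 * g <= vol n (remove_edge E x w) + 2 * S (length p))%nat by lia.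
    apply IH; auto.
    + destruct HE as [Hsym Hsub]. split; [now apply remove_edge_sym|].
      intros a b Hab. eapply Hsub, remove_edge_sub, Hab.
    + now apply on_trail_step.
    + discriminate.
Qed.

Lemma parity_closed E s s' : parity n E s s -> parity n E s' s'.
Proof. intros H v Hv. rewrite H by assumption. now rewrite !xorb_nilpotent. Qed.

Lemma on_trail_start E x : parity n E x x -> on_trail n adj E [x] x.
Proof. intros H. repeat split; auto. Qed.

Lemma even_vol_ge E s : sub_relation E -> parity n E s s -> (0 < vol n E)%nat ->
  (2 * g <= vol n E)%nat.
Proof.
  intros HE Hp Hv. destruct (vol_pos_edge n E Hv) as [x [w [Hx [Hw Hxw]]]].
  destruct (sub_relation_facts E x w HE Hxw) as [Hne _].
  assert (H : (2 * g <= vol n (remove_edge E x w) + 2 * length [x])%nat).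
  { apply (on_trail_vol_ge _ w [x] x); auto.
    - destruct HE as [Hsym Hsub]. split; [now apply remove_edge_sym|].
      intros a b Hab. eapply Hsub, remove_edge_sub, Hab.
    - apply on_trail_step; auto. apply on_trail_start. now apply (parity_closed E s).
    - discriminate. }
  assert (vol n (remove_edge E x w) + 2 = vol n E)%nat by (apply vol_remove_edge; auto; apply HE).
  simpl in *. lia.
Qed.
End Trails.

(** * The greedy random walk *)

Definition unused adj (h : list nat) (u v : nat) : bool := adj u v && negb (used h u v).

Definition all_used n adj (h : list nat) : bool :=
  forallb (fun u => forallb (fun v => negb (adj u v) || used h u v) (seq 0 n)) (seq 0 n).

(** Expected number of further steps until coverage, cut off at [k], given the history [h]. *)
Fixpoint remaining n d adj Rl (k : nat) (h : list nat) : R :=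
  match k with
  | O => 0
  | S k' => if all_used n adj h then 0
            else 1 + sumR n (fun w => trans n d adj Rl h w * remaining n d adj Rl k' (h ++ [w]))
  end.

Lemma used_snoc h w u v : h <> [] ->
  used (h ++ [w]) u v = used h u v ||
    ((Nat.eqb (last h 0%nat) u && Nat.eqb w v) || (Nat.eqb (last h 0%nat) v && Nat.eqb w u)).
Proof.
  induction h as [|a [|b t] IH]; intros Hh; [congruence| |].
  - simpl. now rewrite orb_false_r.
  - assert (Hbt : b :: t <> []) by discriminate. specialize (IH Hbt).
    change (((Nat.eqb a u && Nat.eqb b v) || (Nat.eqb a v && Nat.eqb b u)) || used ((b :: t) ++ [w]) u v
      = (((Nat.eqb a u && Nat.eqb b v) || (Nat.eqb a v && Nat.eqb b u)) || used (b :: t) u v)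
        || ((Nat.eqb (last (b :: t) 0%nat) u && Nat.eqb w v) || (Nat.eqb (last (b :: t) 0%nat) v && Nat.eqb w u))).
    now rewrite IH, orb_assoc.
Qed.

Lemma unused_snoc adj h w : h <> [] ->
  unused adj (h ++ [w]) = remove_edge (unused adj h) (last h 0%nat) w.
Proof.
  intros Hh. extensionality u; extensionality v. unfold unused, remove_edge.
  now rewrite used_snoc, negb_orb, andb_assoc.
Qed.

Lemma used_sym h u v : used h u v = used h v u.
Proof.
  induction h as [|a [|b t] IH]; [reflexivity|reflexivity|].
  change (((Nat.eqb a u && Nat.eqb b v) || (Nat.eqb a v && Nat.eqb b u)) || used (b :: t) u v
    = ((Nat.eqb a v && Nat.eqb b u) || (Nat.eqb a u && Nat.eqb b v)) || used (b :: t) v u).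
  now rewrite IH, (orb_comm (Nat.eqb a u && Nat.eqb b v)).
Qed.

Lemma unused_sub_relation n adj h : simple_graph n adj -> sub_relation adj (unused adj h).
Proof.
  intros [Hsym _]. split.
  - intros a b. unfold unused. now rewrite Hsym, used_sym.
  - intros a b Hab. unfold unused in Hab. now apply andb_prop in Hab.
Qed.

Lemma has_unused_false n adj h : has_unused n adj h = false ->
  forall w, (w < n)%nat -> unused adj h (last h 0%nat) w = false.
Proof.
  intros H w Hw. apply not_true_is_false; intros Ht.
  assert (has_unused n adj h = true); [|congruence].
  apply existsb_exists. exists w. split; [apply in_seq; lia|exact Ht].
Qed.

Lemma has_unused_false_degree n adj h : has_unused n adj h = false ->
  degree n (unused adj h) (last h 0%nat) = 0%nat.
Proof.
  intros H. unfold degree. rewrite (sumN_ext n _ (fun _ => 0%nat)).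
  - clear. induction n as [|k IH]; [reflexivity|]. now rewrite sumN_S, IH.
  - intros w Hw. now rewrite (has_unused_false n adj h H w Hw).
Qed.

Lemma has_unused_true_degree n adj h : has_unused n adj h = true ->
  (0 < degree n (unused adj h) (last h 0%nat))%nat.
Proof.
  intros H. apply existsb_exists in H. destruct H as [w [Hw Hu]]. apply in_seq in Hw.
  apply (degree_pos n _ _ w); [lia|exact Hu].
Qed.

Lemma not_all_used_vol n adj h : all_used n adj h = false -> (0 < vol n (unused adj h))%nat.
Proof.
  intros H. apply NNPP; intros Hv. assert (all_used n adj h = true); [|congruence].
  apply forallb_forall; intros u Hu. apply forallb_forall; intros v Hw.
  apply in_seq in Hu, Hw.
  destruct (adj u v) eqn:Ha; [|reflexivity]. simpl.
  destruct (used h u v) eqn:Hused; [reflexivity|]. exfalso; apply Hv.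
  apply (edge_vol_pos n _ u v); [lia|lia|]. unfold unused. now rewrite Ha, Hused.
Qed.

(** * Conditional expectations along the walk *)

Section Expectation.
Variables (n d : nat) (adj : nat -> nat -> bool) (Rl : list nat -> nat -> R).
Hypotheses (Hd : (0 < d)%nat) (Hreg : regular n d adj) (Hrule : valid_rule n adj Rl).

Lemma trans_nonneg h w : 0 <= trans n d adj Rl h w.
Proof.
  unfold trans. destruct (has_unused n adj h) eqn:Hu.
  - destruct (unused_edge adj h w); [now apply Hrule|lra].
  - exact (normA_nonneg d adj (last h 0%nat) w Hd).
Qed.

Lemma sum_trans h : (last h 0 < n)%nat -> sumR n (trans n d adj Rl h) = 1.
Proof.
  intros Hx. unfold trans. destruct (has_unused n adj h) eqn:Hu.
  - now apply Hrule.
  - exact (sum_normA n d adj _ Hd Hreg Hx).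
Qed.

Lemma last_snoc_lt (h : list nat) w : (w < n)%nat -> (last (h ++ [w]) 0 < n)%nat.
Proof. now rewrite last_last. Qed.

Lemma expect_ext k h f f' : (forall q, length q = k -> f (h ++ q) = f' (h ++ q)) ->
  expect n d adj Rl k h f = expect n d adj Rl k h f'.
Proof.
  revert h. induction k as [|k IH]; intros h H; simpl.
  - specialize (H [] eq_refl). now rewrite app_nil_r in H.
  - apply sumR_ext; intros w Hw. f_equal. apply IH. intros q Hq.
    rewrite <- app_assoc. apply H. simpl; now rewrite Hq.
Qed.

Lemma expect_const k h c : (last h 0 < n)%nat -> expect n d adj Rl k h (fun _ => c) = c.
Proof.
  revert h. induction k as [|k IH]; intros h Hx; simpl; [reflexivity|].
  rewrite (sumR_ext n _ (fun w => c * trans n d adj Rl h w))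
    by (intros; rewrite IH by (now apply last_snoc_lt); ring).
  rewrite sumR_scal, sum_trans by assumption. ring.
Qed.

Lemma expect_cover_from k h t : (last h 0 < n)%nat -> length h = S t ->
  expect n d adj Rl k h (fun p => INR (cover_from n adj p t k)) = INR t + remaining n d adj Rl k h.
Proof.
  revert h t. induction k as [|k IH]; intros h t Hx Hlen; [simpl; ring|].
  (* A history of length [S t] is X_0, ..., X_t, so coverage at time [t] reads exactly [h], whatever
     follows. *)
  assert (Hcov : forall q, covered n adj (h ++ q) t = all_used n adj h).
  { intros q. unfold covered, all_used. rewrite <- Hlen, firstn_app, firstn_all, Nat.sub_diag.
    simpl. now rewrite app_nil_r. }
  cbn [remaining]. destruct (all_used n adj h) eqn:Hall.
  - rewrite (expect_ext (S k) h _ (fun _ => INR t))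
      by (intros; cbn [cover_from]; now rewrite Hcov).
    rewrite expect_const by assumption. ring.
  - rewrite (expect_ext (S k) h _ (fun p => INR (cover_from n adj p (S t) k)))
      by (intros; cbn [cover_from]; now rewrite Hcov).
    cbn [expect].
    rewrite (sumR_ext n _ (fun w => INR (S t) * trans n d adj Rl h w
              + trans n d adj Rl h w * remaining n d adj Rl k (h ++ [w]))).
    + rewrite sumR_plus, sumR_scal, sum_trans, S_INR by assumption. ring.
    + intros w Hw. rewrite IH; [ring|now apply last_snoc_lt|].
      rewrite length_app, Hlen; simpl; lia.
Qed.

Lemma sum_trans_le h f c : (last h 0 < n)%nat ->
  (forall w, (w < n)%nat -> trans n d adj Rl h w <> 0 -> f w <= c) ->
  sumR n (fun w => trans n d adj Rl h w * f w) <= c.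
Proof.
  intros Hx Hf. rewrite <- (Rmult_1_r c), <- (sum_trans h Hx), <- sumR_scal.
  apply sumR_le; intros w Hw. rewrite (Rmult_comm c).
  destruct (Req_dec (trans n d adj Rl h w) 0) as [->|Hne]; [lra|].
  apply Rmult_le_compat_l; auto using trans_nonneg.
Qed.
End Expectation.

(** * The potential argument *)

Section Potential.
Variables (n d g : nat) (adj : nat -> nat -> bool) (Rl : list nat -> nat -> R).
Hypotheses (Hd : (0 < d)%nat) (Hgr : simple_graph n adj) (Hreg : regular n d adj)
  (Hrule : valid_rule n adj Rl)
  (Hgirth : forall c, is_cycle adj c -> (g <= length c)%nat).

Definition active (E : nat -> nat -> bool) (v : nat) : bool := (0 <? degree n E v)%nat.

(* H v bounds the expected hitting time of the vertices with unused edges when the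
   unused degrees add up to v; F v bounds the expected total duration of all random
   phases from then on. *)
Variables (F H : nat -> R).
Hypotheses
  (HF0 : forall v, 0 <= F v)
  (HF : forall v v', (v' + 2 * g <= v)%nat -> (0 < v)%nat -> F v' + H v <= F v)
  (Hhit : forall E k x, sub_relation adj E -> (0 < vol n E)%nat -> (x < n)%nat ->
     hit n d adj (active E) k x <= H (vol n E)).

(** The case [v' = 0] of [HF]. It makes the bounds below nonnegative, as they must be once the
    horizon is exhausted or all edges are used. *)
Lemma F_ge_H v : (0 < v)%nat -> (2 * g <= v)%nat -> H v <= F v.
Proof.
  intros Hv Hg. specialize (HF v 0 ltac:(lia) Hv). specialize (HF0 0%nat). lra.
Qed.

(** A greedy step costs 1 and lowers the volume by 2, so half the volume pays for it whichever edge
    the rule picks. *)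
Lemma greedy_step (k : nat) h c : (last h 0 < n)%nat -> h <> [] ->
  has_unused n adj h = true ->
  (forall w, (w < n)%nat -> unused adj h (last h 0%nat) w = true ->
     remaining n d adj Rl k (h ++ [w]) <= INR (vol n (unused adj (h ++ [w]))) / 2 + c) ->
  1 + sumR n (fun w => trans n d adj Rl h w * remaining n d adj Rl k (h ++ [w]))
  <= INR (vol n (unused adj h)) / 2 + c.
Proof.
  intros Hx Hne Hu Hk.
  assert (sumR n (fun w => trans n d adj Rl h w * remaining n d adj Rl k (h ++ [w]))
          <= INR (vol n (unused adj h)) / 2 + c - 1); [|lra].
  apply sum_trans_le; auto. intros w Hw Ht. unfold trans in Ht. rewrite Hu in Ht.
  destruct (unused_edge adj h w) eqn:Hxw; [|congruence].
  change (unused adj h (last h 0%nat) w = true) in Hxw.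
  eapply Rle_trans; [now apply Hk|].
  assert (HE : sub_relation adj (unused adj h)) by (now apply (unused_sub_relation n)).
  destruct (sub_relation_facts n adj Hgr _ _ _ HE Hxw) as [Hxne _].
  rewrite <- (vol_remove_edge n (unused adj h) (last h 0%nat) w) by (auto; apply HE).
  rewrite unused_snoc, plus_INR by assumption. simpl. lra.
Qed.

(** Two states are tracked together. Outside excursions, the share [H] that [F] reserves for the
    current phase is replaced by the actual [hit]. Inside an excursion, [v0] is the volume at its
    start, which stays constant because each step moves 2 from the volume to the trail; that phase
    is already over, so F v0 - H v0 remains for the later ones. *)
Lemma remaining_bound k :
  (forall h, h <> [] -> (last h 0 < n)%nat -> let E := unused adj h in
     parity n E (last h 0%nat) (last h 0%nat) -> (0 < vol n E)%nat ->
     remaining n d adj Rl k h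
     <= INR (vol n E) / 2 + (hit n d adj (active E) k (last h 0%nat) + F (vol n E) - H (vol n E)))
  /\
  (forall h p s, h <> [] -> (last h 0 < n)%nat -> let E := unused adj h in
     on_trail n adj E (last h 0%nat :: p) s -> p <> [] ->
     let v0 := (vol n E + 2 * length p)%nat in
     remaining n d adj Rl k h <= INR (vol n E) / 2 + (F v0 - H v0)).
Proof.
  assert (HposR : forall j h, (last h 0 < n)%nat ->
     parity n (unused adj h) (last h 0%nat) (last h 0%nat) -> (0 < vol n (unused adj h))%nat ->
     0 <= INR (vol n (unused adj h)) / 2
          + (hit n d adj (active (unused adj h)) j (last h 0%nat)
             + F (vol n (unused adj h)) - H (vol n (unused adj h)))).
  { intros j h Hx Hpar Hv.
    assert (Hge := even_vol_ge n g adj Hgr Hgirth _ _ (unused_sub_relation n adj h Hgr) Hpar Hv).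
    generalize (F_ge_H _ Hv Hge) (pos_INR (vol n (unused adj h)))
      (hit_nonneg n d adj (active (unused adj h)) j (last h 0%nat) Hd). lra. }
  assert (HposG : forall h p s, (last h 0 < n)%nat ->
     on_trail n adj (unused adj h) (last h 0%nat :: p) s -> p <> [] ->
     0 <= INR (vol n (unused adj h)) / 2
          + (F (vol n (unused adj h) + 2 * length p)%nat - H (vol n (unused adj h) + 2 * length p)%nat)).
  { intros h p s Hx Ht Hp.
    assert (Hge := on_trail_vol_ge n g adj Hgr Hgirth _ _ _ _ (unused_sub_relation n adj h Hgr) Hx Ht Hp).
    assert (Hv : (0 < vol n (unused adj h) + 2 * length p)%nat)
      by (destruct p; [congruence|simpl; lia]).
    generalize (F_ge_H _ Hv Hge) (pos_INR (vol n (unused adj h))). lra. }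
  induction k as [|k [IHR IHG]].
  { split; intros; simpl remaining; [now apply HposR|now apply (HposG h p s)]. }
  (* Proved first: the stuck case of the second clause invokes it at the same horizon [S k]. *)
  assert (HR : forall h, h <> [] -> (last h 0 < n)%nat -> let E := unused adj h in
     parity n E (last h 0%nat) (last h 0%nat) -> (0 < vol n E)%nat ->
     remaining n d adj Rl (S k) h
     <= INR (vol n E) / 2 + (hit n d adj (active E) (S k) (last h 0%nat) + F (vol n E) - H (vol n E))).
  { intros h Hne Hx E Hpar Hv.
    assert (HE : sub_relation adj E) by (now apply (unused_sub_relation n)).
    set (x := last h 0%nat) in *.
    cbn [remaining]. destruct (all_used n adj h); [now apply HposR|].
    destruct (has_unused n adj h) eqn:Hu.
    (* An excursion opens: [hit] is 0 at an active vertex, and the first edge is counted by the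
       trail, so [v0] is the present volume. *)
    - apply greedy_step; auto. intros w Hw Hxw.
      assert (Hact : active E x = true).
      { apply Nat.ltb_lt. now apply has_unused_true_degree. }
      cbn [hit]. rewrite Hact.
      assert (Hvw : (vol n (remove_edge E x w) + 2 = vol n E)%nat).
      { apply vol_remove_edge; auto; [apply HE|]. now apply (sub_relation_facts n adj Hgr E). }
      specialize (IHG (h ++ [w]) [x] x).
      cbv zeta in IHG. rewrite last_last, unused_snoc in IHG by assumption. fold x E in IHG.
      rewrite unused_snoc by assumption. fold x E.
      replace (vol n (remove_edge E x w) + 2 * length [x])%nat with (vol n E) in IHG by (simpl; lia).
      replace (0 + F (vol n E) - H (vol n E)) with (F (vol n E) - H (vol n E)) by ring.
      apply IHG; auto.
      + intros Hnil; apply app_eq_nil in Hnil; now destruct Hnil.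
      + apply (on_trail_step n adj Hgr); auto. now apply on_trail_start.
      + discriminate.
    - assert (Hact : active E x = false).
      { apply Nat.ltb_ge. apply Nat.eq_le_incl. exact (has_unused_false_degree n adj h Hu). }
      cbn [hit]. rewrite Hact.
      rewrite (sumR_ext n _ (fun w => normA d adj x w * remaining n d adj Rl k (h ++ [w])))
        by (intros w Hw; unfold trans; now rewrite Hu).
      change (sumR n (fun w => normA d adj x w * remaining n d adj Rl k (h ++ [w])))
        with (avg n d adj (fun w => remaining n d adj Rl k (h ++ [w])) x).
      set (c := INR (vol n E) / 2 + F (vol n E) - H (vol n E)).
      assert (Hle : avg n d adj (fun w => remaining n d adj Rl k (h ++ [w])) x
                    <= avg n d adj (fun w => c + hit n d adj (active E) k w) x).
      { apply avg_le; [exact Hd|]. intros w Hw.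
        assert (Hsame : unused adj (h ++ [w]) = E).
        { rewrite unused_snoc by assumption. apply remove_edge_absent; [apply HE|].
          now apply (has_unused_false n). }
        specialize (IHR (h ++ [w])). cbv zeta in IHR. rewrite last_last, Hsame in IHR.
        unfold c. eapply Rle_trans; [apply IHR|].
        - intros Hnil; apply app_eq_nil in Hnil; now destruct Hnil.
        - exact Hw.
        - now apply (parity_closed n E x).
        - exact Hv.
        - lra. }
      rewrite (avg_plus n d adj (fun _ => c)), avg_const in Hle by assumption.
      unfold c in Hle.
      change (avg n d adj (fun i => hit n d adj (active E) k i) x)
        with (avg n d adj (hit n d adj (active E) k) x) in Hle. lra. }
  split; [exact HR|].
  intros h p s Hne Hx E Ht Hp v0.
  assert (HE : sub_relation adj E) by (now apply (unused_sub_relation n)).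
  set (x := last h 0%nat) in *.
  destruct (all_used n adj h) eqn:Hall.
  { cbn [remaining]. rewrite Hall. now apply (HposG h p s). }
  destruct (has_unused n adj h) eqn:Hu.
  - cbn [remaining]. rewrite Hall. apply greedy_step; auto. intros w Hw Hxw.
    assert (Hvw : (vol n (remove_edge E x w) + 2 = vol n E)%nat).
    { apply vol_remove_edge; auto; [apply HE|]. now apply (sub_relation_facts n adj Hgr E). }
    specialize (IHG (h ++ [w]) (x :: p) s).
    cbv zeta in IHG. rewrite last_last, unused_snoc in IHG by assumption. fold x E in IHG.
    rewrite unused_snoc by assumption. fold x E.
    replace (vol n (remove_edge E x w) + 2 * length (x :: p))%nat with v0 in IHG
      by (unfold v0; simpl; lia).
    apply IHG; auto.
    + intros Hnil; apply app_eq_nil in Hnil; now destruct Hnil.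
    + now apply (on_trail_step n adj Hgr).
    + discriminate.
  (* The excursion closes after at least g edges, so [HF] leaves F (vol E) <= F v0 - H v0; the new
     phase fits in it because its [hit] is at most H (vol E). *)
  - assert (Hdeg := has_unused_false_degree n adj h Hu). fold x E in Hdeg.
    destruct (on_trail_stuck n g adj Hgr Hgirth E x p s Hx Ht Hp Hdeg) as [Hs Hlen].
    assert (Hv : (0 < vol n E)%nat) by now apply not_all_used_vol.
    assert (Hpar : parity n E x x) by (destruct Ht as [_ [_ [_ Hpar]]]; now rewrite Hs in Hpar).
    specialize (HR h Hne Hx). cbv zeta in HR. fold x E in HR. specialize (HR Hpar Hv).
    generalize (Hhit E (S k) x HE Hv Hx).
    assert (Hv0 : (vol n E + 2 * g <= v0)%nat) by (unfold v0; lia).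
    generalize (HF v0 (vol n E) Hv0 ltac:(lia)). lra.
Qed.
End Potential.

(** * Numerical estimates *)

Lemma ln_le_sub_1 (x : R) : 0 < x -> ln x <= x - 1.
Proof. intros Hx. generalize (exp_ineq1_le (ln x)). rewrite exp_ln by assumption. lra. Qed.

(** Induction through 1/(N+1) <= ln (N+1) - ln N, which is ln x <= x - 1 at x = N/(N+1). *)
Lemma harmonic_le (N : nat) : (0 < N)%nat -> sumR N (fun i => / INR (S i)) <= 1 + ln (INR N).
Proof.
  induction N as [|N IH]; intros HN; [lia|]. rewrite sumR_S.
  destruct (Nat.eq_dec N 0) as [->|HN0].
  - unfold sumR; simpl. rewrite ln_1. lra.
  - specialize (IH ltac:(lia)).
    assert (HNp : 0 < INR N) by (apply lt_0_INR; lia).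
    assert (HSp : 0 < INR (S N)) by (apply lt_0_INR; lia).
    assert (Hl := ln_le_sub_1 (INR N / INR (S N)) (Rdiv_lt_0_compat _ _ HNp HSp)).
    assert (Hinv := Rinv_0_lt_compat _ HSp).
    unfold Rdiv in Hl. rewrite ln_mult, ln_Rinv in Hl by assumption.
    replace (INR N * / INR (S N) - 1) with (- / INR (S N)) in Hl
      by (rewrite S_INR in *; field; lra).
    lra.
Qed.

(** At least [m] terms are added, each no smaller than the last one. With a i = H (i+1) and m = 2g,
    division by 2g gives the inequality required of [F]. *)
Lemma sumR_decreasing_increment (a : nat -> R) v v' m :
  (forall i j, (i <= j)%nat -> a j <= a i) -> (forall i, 0 <= a i) ->
  (v' + m <= v)%nat -> (0 < v)%nat -> sumR v' a + INR m * a (v - 1)%nat <= sumR v a.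
Proof.
  intros Hdec Hpos Hv Hv0. revert m Hv.
  assert (Hk : forall k, (v' + k <= v)%nat -> sumR v' a + INR k * a (v - 1)%nat <= sumR (v' + k) a).
  { induction k as [|k IH]; intros Hk; [rewrite Nat.add_0_r; simpl; lra|].
    rewrite Nat.add_succ_r, sumR_S, S_INR. specialize (IH ltac:(lia)).
    assert (a (v - 1)%nat <= a (v' + k)%nat) by (apply Hdec; lia). lra. }
  intros m Hm. specialize (Hk (v - v')%nat ltac:(lia)).
  replace (v' + (v - v'))%nat with v in Hk by lia.
  assert (INR m * a (v - 1)%nat <= INR (v - v') * a (v - 1)%nat)
    by (apply Rmult_le_compat_r; [apply Hpos|apply le_INR; lia]).
  lra.
Qed.

Lemma vol_num_edges n adj : simple_graph n adj -> vol n adj = (2 * num_edges n adj)%nat.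
Proof.
  intros [Hsym [Hirr _]].
  assert (H : vol n adj = (num_edges n adj
    + sumN n (fun u => sumN n (fun v => if (v <? u)%nat && adj v u then 1%nat else 0%nat)))%nat).
  { unfold vol, num_edges, degree. rewrite <- sumN_plus. apply sumN_ext; intros u Hu.
    rewrite <- sumN_plus. apply sumN_ext; intros v Hv. rewrite (Hsym v u).
    destruct (Nat.ltb_spec u v), (Nat.ltb_spec v u); try lia; simpl.
    - lia.
    - lia.
    - replace v with u by lia. now rewrite Hirr. }
  rewrite H, sumN_swap. fold (num_edges n adj). lia.
Qed.

Lemma vol_regular n d adj : regular n d adj -> vol n adj = (n * d)%nat.
Proof.
  intros Hr. unfold vol. rewrite (sumN_ext n _ (fun _ => d)) by exact Hr.
  clear. induction n as [|n IH]; [reflexivity|]. rewrite sumN_S, IH; lia.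
Qed.

Lemma degree_le_n n E u : (degree n E u <= n)%nat.
Proof.
  unfold degree. apply Nat.le_trans with (sumN n (fun _ => 1%nat)).
  - apply sumN_le; intros; destruct (E u i); lia.
  - clear. induction n as [|n IH]; [apply le_n|]. rewrite sumN_S; lia.
Qed.

Lemma vol_le_card n d adj E : regular n d adj -> sub_relation adj E ->
  INR (vol n E) <= INR d * card n (active n E).
Proof.
  intros Hr [_ Hsub]. unfold vol, card. rewrite INR_sumN, <- sumR_scal.
  apply sumR_le; intros u Hu.
  assert (Hle : (degree n E u <= d)%nat).
  { rewrite <- (Hr u Hu). apply degree_le. intros; now apply Hsub. }
  unfold active. destruct (Nat.ltb_spec 0 (degree n E u)).
  - rewrite Rmult_1_r. now apply le_INR.
  - replace (degree n E u) with 0%nat by lia. simpl; lra.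
Qed.

Lemma girth_eq_ge_3 adj g : girth_eq adj g -> (3 <= g)%nat.
Proof. intros [[c [[Hc _] <-]] _]. exact Hc. Qed.

Lemma girth_eq_degree_pos n d adj g :
  simple_graph n adj -> regular n d adj -> girth_eq adj g -> (0 < d)%nat.
Proof.
  intros [_ [_ Hlt]] Hr [[c [[_ [_ [_ Hc]]] _]] _].
  destruct (Hlt _ _ Hc) as [Hu Hv]. rewrite <- (Hr _ Hu). now apply (degree_pos n adj _ _ Hv).
Qed.

(** * Choice of the potential and of the constant *)

Theorem mainTheorem5 :
  exists C : R, 0 < C /\
  forall (n d : nat) (lam : R) (adj : nat -> nat -> bool) (g : nat),
    (2 <= n)%nat ->
    Nat.Even d ->
    expander n d adj lam ->
    girth_eq adj g ->
    forall (Rl : list nat -> nat -> R) (v0 : nat),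
      valid_rule n adj Rl ->
      (v0 < n)%nat ->
      forall T : nat,
        exp_cover_trunc n d adj Rl v0 T
        <= INR (num_edges n adj)
           + C * INR (num_edges n adj) * ln (INR n) / ((1 - lam) * INR g).
Proof.
  (* With m = |E| and nd = 2m, the harmonic part contributes 8m * 4 ln n and the mixing part 2m * 3
     ln n, both over 1 - lam; the factor 1/(2g) turns 32 + 6 into 19. *)
  exists 19. split; [lra|].
  intros n d lam adj g Hn Heven Hexp Hgirth Rl v0 Hrule Hv0 T.
  assert (Hgr : simple_graph n adj) by apply Hexp.
  assert (Hreg : regular n d adj) by apply Hexp.
  assert (Hlam1 : lam < 1) by apply Hexp.
  assert (Hg3 := girth_eq_ge_3 adj g Hgirth).
  assert (Hd := girth_eq_degree_pos n d adj g Hgr Hreg Hgirth).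
  destruct (spectral_contraction n d adj lam Hn Hd Hexp) as [Hlam0 _].
  assert (HnR : 0 < INR n) by (apply lt_0_INR; lia).
  assert (HdR : 0 < INR d) by (apply lt_0_INR; lia).
  assert (HgR : 0 < INR g) by (apply lt_0_INR; lia).
  assert (Hln := ln_ge_half n Hn).
  (* [A] and [B] come from [hit_bound], with |S| bounded below by the volume over d. *)
  set (A := 4 * INR n * INR d / (1 - lam)).
  set (B := 3 * ln (INR n) / (1 - lam)).
  assert (HA : 0 < A) by (unfold A; apply Rdiv_lt_0_compat; nra).
  assert (HB : 0 < B) by (unfold B; apply Rdiv_lt_0_compat; lra).
  set (H := fun v : nat => A * / INR v + B).
  (* The sum runs over H 1, ..., H v; the shift avoids the inverse of 0. *)
  set (F := fun v : nat => / (2 * INR g) * sumR v (fun i => H (S i))).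
  assert (Hginv : 0 < / (2 * INR g)) by (apply Rinv_0_lt_compat; lra).
  assert (HHpos : forall i, 0 <= H (S i)).
  { intros i. unfold H. assert (0 < / INR (S i)) by (apply Rinv_0_lt_compat, lt_0_INR; lia). nra. }
  assert (HHdec : forall i j, (i <= j)%nat -> H (S j) <= H (S i)).
  { intros i j Hij. unfold H.
    assert (/ INR (S j) <= / INR (S i))
      by (apply Rinv_le_contravar; [apply lt_0_INR; lia|apply le_INR; lia]). nra. }
  assert (HF0 : forall v, 0 <= F v).
  { intros v. apply Rmult_le_pos; [lra|]. now apply sumR_nonneg. }
  assert (HF : forall v v', (v' + 2 * g <= v)%nat -> (0 < v)%nat -> F v' + H v <= F v).
  { intros v v' Hvv Hv.
    assert (Hinc := sumR_decreasing_increment (fun i => H (S i)) v v' (2 * g) HHdec HHpos Hvv Hv).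
    cbv beta in Hinc. replace (S (v - 1)) with v in Hinc by lia.
    rewrite mult_INR in Hinc. simpl (INR 2) in Hinc.
    apply (Rmult_le_compat_l (/ (2 * INR g))) in Hinc; [|lra].
    unfold F. eapply Rle_trans; [|exact Hinc]. right; field; lra. }
  assert (Hhit : forall E k x, sub_relation adj E -> (0 < vol n E)%nat -> (x < n)%nat ->
     hit n d adj (active n E) k x <= H (vol n E)).
  { intros E k x HE Hv Hx. assert (Hvol := vol_le_card n d adj E Hreg HE).
    assert (HvR : 0 < INR (vol n E)) by now apply lt_0_INR.
    assert (Hcard : 0 < card n (active n E)) by nra.
    eapply Rle_trans; [now apply (hit_bound n d adj lam)|].
    unfold H. fold B. apply Rplus_le_compat_r. unfold A.
    replace (4 * INR n / ((1 - lam) * card n (active n E)))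
      with (4 * INR n * INR d / (1 - lam) * / (INR d * card n (active n E)))
      by (field; repeat split; lra).
    apply Rmult_le_compat_l; [fold A; lra|]. now apply Rinv_le_contravar. }
  assert (Hinit : unused adj [v0] = adj).
  { extensionality u; extensionality v. unfold unused. simpl. apply andb_true_r. }
  assert (Hvol : vol n adj = (n * d)%nat) by now apply vol_regular.
  assert (Hvolpos : (0 < vol n adj)%nat) by (rewrite Hvol; lia).
  assert (Hpar : parity n adj v0 v0).
  { intros v Hv. rewrite xorb_nilpotent, (Hreg v Hv), <- Nat.negb_even.
    apply Nat.even_spec in Heven. now rewrite Heven. }
  destruct (remaining_bound n d g adj Rl Hd Hgr Hreg Hrule (proj2 Hgirth) F H HF0 HF Hhit T) as [HR _].
  specialize (HR [v0] ltac:(discriminate) Hv0). cbv zeta in HR. rewrite Hinit in HR.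
  specialize (HR Hpar Hvolpos).
  change (last [v0] 0%nat) with v0 in HR.
  (* Initially [hit] is at most [H], so the bound reduces to half the volume plus [F]. *)
  assert (Hh := Hhit adj T v0 (conj (proj1 Hgr) (fun a b Hab => Hab)) Hvolpos Hv0).
  unfold exp_cover_trunc, cover_trunc.
  rewrite (expect_cover_from n d adj Rl Hd Hreg Hrule T [v0] 0 Hv0 eq_refl).
  assert (HE2 := f_equal INR (vol_num_edges n adj Hgr)). rewrite mult_INR in HE2. simpl (INR 2) in HE2.
  set (m := INR (num_edges n adj)) in *.
  assert (Hnd : INR n * INR d = 2 * m) by (rewrite <- mult_INR, <- Hvol; exact HE2).
  assert (Hharm := harmonic_le (vol n adj) Hvolpos).
  assert (Hlnvol : ln (INR (vol n adj)) <= 2 * ln (INR n)).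
  (* A degree is at most n, so the volume nd is at most n^2. *)
  { replace (2 * ln (INR n)) with (ln (INR n * INR n)) by (rewrite ln_mult by lra; ring).
    apply ln_le_mono; [now apply lt_0_INR|]. rewrite Hvol, mult_INR.
    apply Rmult_le_compat_l; [lra|]. apply le_INR. rewrite <- (Hreg v0 Hv0). apply degree_le_n. }
  assert (HFle : F (vol n adj) <= 19 * m * ln (INR n) / ((1 - lam) * INR g)).
  { unfold F, H. rewrite sumR_plus, sumR_scal, sumR_const, HE2.
    assert (Hm : 0 <= m) by apply pos_INR.
    replace (19 * m * ln (INR n) / ((1 - lam) * INR g))
      with (/ (2 * INR g) * (A * (4 * ln (INR n)) + 2 * m * B)).
    (* 1 + 2 ln n <= 4 ln n, since ln n >= 1/2. *)
    - apply Rmult_le_compat_l; [lra|]. apply Rplus_le_compat_r, Rmult_le_compat_l; lra.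
    - unfold A, B. replace (4 * INR n * INR d) with (8 * m) by lra. field. split; lra. }
  simpl INR at 1. lra.
Qed.
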